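(* There exist a Bloch function $b\in\mathcal{B}$ and an interpolating sequence $(z_n)_{n\in\mathbb{N}}$ in $\mathbb{D}\setminus\{0\}$ such that for every $\lambda>0$, $$\sum_{n\in\mathbb{N}}\exp\!\left(\frac{\lambda|b(z_n)-b(0)|^2}{-\log(1-|z_n|^2)}\right)(1-|z_n|^2)=\infty.$$
   Context: $\mathbb{D}$ is the open unit disc. The Bloch space $\mathcal{B}$ is the space of holomorphic $b$ on $\mathbb{D}$ with $\|b\|_{\mathcal{B}}=|b(0)|+\sup_{z\in\mathbb{D}}|b'(z)|(1-|z|^2)<\infty$. A sequence $(z_n)$ in $\mathbb{D}$ is interpolating (for $H^\infty$) if for every bounded sequence $(w_n)$ there is a bounded holomorphic $\phi$ on $\mathbb{D}$ with $\phi(z_n)=w_n$ for all $n$; equivalently (Carleson), $\inf_{n\ne j}\rho(z_n,z_j)>0$ and $\sup_{z\in\mathbb{D}}\sum_n(1-\rho^2(z,z_n))<\infty$, where $\rho(z,w)=\left|\frac{w-z}{1-\bar wz}\right|$. *)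

(* Defs.v *)
From Stdlib Require Import Reals.
From Coquelicot Require Import Coquelicot.
Open Scope R_scope.

Definition holomorphic_on_disc (f : C -> C) : Prop :=
  forall z : C, Cmod z < 1 ->
    exists l : C, @is_derive C_AbsRing C_NormedModule f z l.

Definition bloch (b : C -> C) : Prop :=
  exists b' : C -> C,
    (forall z : C, Cmod z < 1 -> @is_derive C_AbsRing C_NormedModule b z (b' z)) /\
    exists M : R, forall z : C, Cmod z < 1 -> Cmod (b' z) * (1 - Cmod z ^ 2) <= M.

Definition H_infty (phi : C -> C) : Prop :=
  holomorphic_on_disc phi /\ exists M : R, forall z : C, Cmod z < 1 -> Cmod (phi z) <= M.

Definition interpolating (z : nat -> C) : Prop :=
  (forall n, Cmod (z n) < 1) /\
  forall w : nat -> C, (exists M : R, forall n, Cmod (w n) <= M) ->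
    exists phi : C -> C, H_infty phi /\ forall n, phi (z n) = w n.

(* Main.v *)
(* The function is the lacunary series b(z) = sum_k z^(4^k). At z = (1 - 4^-m) e(x) with x = a/4^m
   its real part is, up to a bounded error, S_m(x) = sum_{i<m} cos(2 pi 4^i x), which behaves like
   a random walk of m steps when a is chosen at random: grouping the 4-adic preimages of a point
   gives the exact second moment and a bound for the fourth, hence S_n >= sqrt(n)/10 with
   probability at least 1/24, and chaining many blocks gives S_n >= H sqrt(n) with a probability
   p(H) > 0 not depending on n.

   A fixed depth m would not do for small lambda, since S_m >= M sqrt(m) has probability about
   exp(-c M^2). As with the law of the iterated logarithm, one stops at a variable depth:
   repeating the trial at ever larger depths on the intervals not yet stopped, half of any given
   4-adic interval gets covered by disjoint 4-adic intervals on whose associated points |b|^2 /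
   log(1/(1-|z|)) is at least of order M^2. Doing this with M = k on an interval of length
   comparable to 4^-k gives terms with sum at least c' exp(c lambda k^2) 4^-k, for every k.

   Disjointness bounds the weighted sums of the matrix |g_n(z_m)|, where g_n(z) = ((1-|z_n|^2)/(1
   - conj(z_n) z))^2, so passing to a sublist of comparable total length makes its off-diagonal
   row sums at most 1/4. The operator (c_n) |-> (sum_n c_n g_n(z_m))_m is then invertible on
   bounded sequences and interpolation is solved by a series sum_n c_n g_n, without Blaschke
   products. *)
Require Import Defs.
From Stdlib Require Import Reals Lra Lia List ClassicalEpsilon.
From Coquelicot Require Import Coquelicot.
Import ListNotations.
Open Scope R_scope.

(** * Sums over lists and partial sums of real series *)

Definition lsum {A : Type} (f : A -> R) (l : list A) : R :=
  fold_right (fun x s => f x + s) 0 l.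

Definition psum (f : nat -> R) (n : nat) : R := lsum f (seq 0 n).

Lemma lsum_app {A} (f : A -> R) l1 l2 : lsum f (l1 ++ l2) = lsum f l1 + lsum f l2.
Proof. induction l1 as [|x l IH]; simpl; [ring|]. rewrite IH; ring. Qed.

Lemma lsum_le {A} (f g : A -> R) l :
  (forall x, In x l -> f x <= g x) -> lsum f l <= lsum g l.
Proof.
  induction l as [|x l IH]; simpl; intros H; [lra|].
  apply Rplus_le_compat; auto.
Qed.

Lemma lsum_ext {A} (f g : A -> R) l :
  (forall x, In x l -> f x = g x) -> lsum f l = lsum g l.
Proof.
  induction l as [|x l IH]; simpl; intros H; [reflexivity|].
  rewrite H, IH; auto.
Qed.

Lemma lsum_plus {A} (f g : A -> R) l : lsum (fun x => f x + g x) l = lsum f l + lsum g l.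
Proof. induction l as [|x l IH]; simpl; [ring|]. rewrite IH; ring. Qed.

Lemma lsum_scal {A} (c : R) (f : A -> R) l : lsum (fun x => c * f x) l = c * lsum f l.
Proof. induction l as [|x l IH]; simpl; [ring|]. rewrite IH; ring. Qed.

Lemma lsum_const {A} (c : R) (l : list A) : lsum (fun _ => c) l = c * INR (length l).
Proof.
  induction l as [|x l IH]; [simpl; ring|].
  change (c + lsum (fun _ => c) l = c * INR (S (length l))). rewrite S_INR, IH; ring.
Qed.

Lemma lsum_nonneg {A} (f : A -> R) l : (forall x, In x l -> 0 <= f x) -> 0 <= lsum f l.
Proof.
  intros H. replace 0 with (lsum (fun _ : A => 0) l) by (rewrite lsum_const; ring).
  now apply lsum_le.
Qed.

Lemma lsum_map {A B} (f : B -> R) (g : A -> B) l : lsum f (map g l) = lsum (fun x => f (g x)) l.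
Proof. induction l as [|x l IH]; simpl; [reflexivity|]. now rewrite IH. Qed.

Lemma lsum_flat_map {A B} (f : B -> R) (g : A -> list B) l :
  lsum f (flat_map g l) = lsum (fun x => lsum f (g x)) l.
Proof. induction l as [|x l IH]; simpl; [reflexivity|]. now rewrite lsum_app, IH. Qed.

Lemma psum_S f n : psum f (S n) = psum f n + f n.
Proof. unfold psum. rewrite seq_S, lsum_app. simpl. ring. Qed.

Lemma psum_sum_n f n : psum f (S n) = sum_n f n.
Proof.
  induction n as [|n IH]; rewrite psum_S.
  - rewrite sum_O. unfold psum; simpl; ring.
  - rewrite IH, sum_Sn. reflexivity.
Qed.

Lemma psum_mono f n m : (forall i, 0 <= f i) -> (n <= m)%nat -> psum f n <= psum f m.
Proof.
  intros Hf; induction 1 as [|m _ IH]; [lra|].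
  rewrite psum_S. specialize (Hf m). lra.
Qed.

Lemma is_series_psum f l : is_series f l <-> is_lim_seq (psum f) l.
Proof.
  split; intros H.
  - apply is_lim_seq_incr_1. apply is_lim_seq_ext with (sum_n f).
    intros n; now rewrite psum_sum_n. exact H.
  - apply is_lim_seq_incr_1 in H.
    apply (is_lim_seq_ext _ (sum_n f)) in H. exact H. intros; apply psum_sum_n.
Qed.

Lemma ex_series_psum_bounded f K :
  (forall n, 0 <= f n) -> (forall N, psum f N <= K) -> ex_series f.
Proof.
  intros Hf HK. destruct (ex_finite_lim_seq_incr (psum f) K) as [l Hl].
  - intros n. rewrite psum_S. specialize (Hf n); lra.
  - exact HK.
  - exists l. now apply is_series_psum.
Qed.

Lemma psum_le_Series f N : ex_series f -> (forall n, 0 <= f n) -> psum f N <= Series f.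
Proof.
  intros Hf H0. apply Series_correct, is_series_psum in Hf.
  apply (is_lim_seq_incr_compare (psum f)); auto.
  intros n; rewrite psum_S; specialize (H0 n); lra.
Qed.

(** * Series of complex numbers *)

Definition csum (f : nat -> C) (n : nat) : C :=
  (psum (fun k => Re (f k)) n, psum (fun k => Im (f k)) n).

Definition CSeries (f : nat -> C) : C :=
  (Series (fun k => Re (f k)), Series (fun k => Im (f k))).

Lemma csum_S f n : csum f (S n) = (csum f n + f n)%C.
Proof. unfold csum. rewrite !psum_S. reflexivity. Qed.

Lemma im_le_Cmod (c : C) : Rabs (Im c) <= Cmod c.
Proof. eapply Rle_trans; [apply Rmax_r|apply Rmax_Cmod]. Qed.

Lemma ex_series_Re f c : (forall n, Cmod (f n) <= c n) -> ex_series c -> ex_series (fun k => Re (f k)).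
Proof.
  intros Hf Hc. apply (ex_series_le (K:=R_AbsRing) (V:=R_CompleteNormedModule) _ c); auto.
  intros n. eapply Rle_trans; [apply re_le_Cmod|apply Hf].
Qed.

Lemma ex_series_Im f c : (forall n, Cmod (f n) <= c n) -> ex_series c -> ex_series (fun k => Im (f k)).
Proof.
  intros Hf Hc. apply (ex_series_le (K:=R_AbsRing) (V:=R_CompleteNormedModule) _ c); auto.
  intros n. eapply Rle_trans; [apply im_le_Cmod|apply Hf].
Qed.

Lemma Cmod_csum_le f N : Cmod (csum f N) <= psum (fun n => Cmod (f n)) N.
Proof.
  induction N as [|N IH].
  - unfold csum, psum; simpl. change (Cmod (RtoC 0) <= 0). rewrite Cmod_0; lra.
  - rewrite csum_S, psum_S. eapply Rle_trans; [apply Cmod_triangle|]. lra.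
Qed.

(** A closed ball contains the limits of its sequences. Taking for [a] zero, a diagonal term or a
    partial sum turns this into a norm bound, an off-diagonal bound or a tail estimate. *)
Lemma CSeries_in_ball f c (a : C) s N0 :
  (forall n, Cmod (f n) <= c n) -> ex_series c ->
  (forall N, (N0 <= N)%nat -> Cmod (csum f N - a) <= s) -> Cmod (CSeries f - a) <= s.
Proof.
  intros Hf Hc HN.
  assert (HR := ex_series_Re f c Hf Hc). assert (HI := ex_series_Im f c Hf Hc).
  apply Series_correct, is_series_psum in HR. apply Series_correct, is_series_psum in HI.
  assert (L : is_lim_seq (fun N => Cmod (csum f N - a)) (Cmod (CSeries f - a))).
  { unfold Cmod. apply (is_lim_seq_continuous sqrt
      (fun N => fst (csum f N - a)%C ^ 2 + snd (csum f N - a)%C ^ 2)).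
    - apply continuity_pt_filterlim, continuous_sqrt.
    - simpl. apply is_lim_seq_plus'; repeat apply is_lim_seq_mult';
        try apply is_lim_seq_const; apply is_lim_seq_plus'; auto; apply is_lim_seq_const. }
  apply is_lim_seq_incr_n with (N := N0) in L.
  refine (is_lim_seq_le (fun N => Cmod (csum f (N + N0) - a)) (fun _ => s) _ s _ L (is_lim_seq_const s)).
  intros n. apply HN. lia.
Qed.

Lemma Cmod_CSeries_le f c s :
  (forall n, Cmod (f n) <= c n) -> ex_series c -> (forall N, psum c N <= s) -> Cmod (CSeries f) <= s.
Proof.
  intros Hf Hc Hs. replace (CSeries f) with (CSeries f - 0)%C by ring.
  apply (CSeries_in_ball f c _ _ 0); auto.
  intros N _. replace (csum f N - 0)%C with (csum f N) by ring.
  eapply Rle_trans; [apply Cmod_csum_le|].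
  eapply Rle_trans; [|apply (Hs N)]. apply lsum_le; auto.
Qed.

Lemma CSeries_plus f g c d :
  (forall n, Cmod (f n) <= c n) -> ex_series c -> (forall n, Cmod (g n) <= d n) -> ex_series d ->
  CSeries (fun n => f n + g n)%C = (CSeries f + CSeries g)%C.
Proof.
  intros Hf Hc Hg Hd. unfold CSeries. apply injective_projections; simpl.
  - rewrite <- Series_plus; eauto using ex_series_Re.
  - rewrite <- Series_plus; eauto using ex_series_Im.
Qed.

Lemma CSeries_scal (a : C) f c :
  (forall n, Cmod (f n) <= c n) -> ex_series c ->
  CSeries (fun n => a * f n)%C = (a * CSeries f)%C.
Proof.
  intros Hf Hc. assert (HR := ex_series_Re f c Hf Hc). assert (HI := ex_series_Im f c Hf Hc).
  unfold CSeries. apply injective_projections; simpl;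
    rewrite <- !Series_scal_l.
  - rewrite <- Series_minus; [reflexivity| |];
    apply (ex_series_scal (K:=R_AbsRing) (V:=R_NormedModule)); auto.
  - rewrite <- Series_plus; [reflexivity| |];
    apply (ex_series_scal (K:=R_AbsRing) (V:=R_NormedModule)); auto.
Qed.

Lemma CSeries_ext f g : (forall n, f n = g n) -> CSeries f = CSeries g.
Proof.
  intros H. unfold CSeries. f_equal; apply Series_ext; intros n; now rewrite H.
Qed.

(** * Termwise complex differentiation by quadratic remainders *)

Lemma is_derive_quadratic_remainder (f : C -> C) (z l : C) (r K : R) :
  0 < r ->
  (forall w, Cmod (w - z) < r -> Cmod (f w - f z - (w - z) * l) <= K * Cmod (w - z) ^ 2) ->
  @is_derive C_AbsRing C_NormedModule f z l.
Proof.
  intros Hr H. split.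
  - apply (is_linear_scal_l (K := C_AbsRing) (V := C_NormedModule) l).
  - intros x Hx.
    apply (is_filter_lim_locally_unique (K := C_AbsRing) (V := AbsRing_NormedModule C_AbsRing)) in Hx.
    subst x.
    intros eps. assert (He := cond_pos eps).
    (* On this ball the quadratic bound drops to [eps] times the first power; the added 1 avoids a
       zero denominator. *)
    assert (Hd : 0 < Rmin r (eps / (Rabs K + 1))).
    { apply Rmin_glb_lt; auto. apply Rdiv_lt_0_compat; auto. assert (h := Rabs_pos K). lra. }
    exists (mkposreal _ Hd). intros y Hy.
    assert (Hy' : Cmod (y - z) < Rmin r (eps / (Rabs K + 1))) by exact Hy.
    assert (H1 : Cmod (y - z) < r) by (eapply Rlt_le_trans; [exact Hy'|apply Rmin_l]).
    assert (H2 : Cmod (y - z) < eps / (Rabs K + 1)) by (eapply Rlt_le_trans; [exact Hy'|apply Rmin_r]).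
    change (Cmod (f y - f z - (y - z) * l) <= eps * Cmod (y - z)).
    eapply Rle_trans; [apply H; auto|].
    assert (HK := Rle_abs K). assert (HK0 := Rabs_pos K). assert (Hc := Cmod_ge_0 (y - z)).
    assert (H3 : Cmod (y - z) * (Rabs K + 1) <= eps).
    { apply Rlt_le. apply (Rmult_lt_compat_r (Rabs K + 1)) in H2; [|lra].
      replace (eps / (Rabs K + 1) * (Rabs K + 1)) with (pos eps) in H2 by (field; lra). exact H2. }
    nra.
Qed.

(** Quadratic remainders add up: the whole series has remainder at most [Series c] times the squared
    increment. The majorant [e] makes values and derivatives summable, so that the three series can
    be combined into one. *)
Lemma is_derive_CSeries (f : nat -> C -> C) (f' : nat -> C) (z : C) (r : R) (c e : nat -> R) :
  0 < r -> ex_series c -> ex_series e ->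
  (forall n w, Cmod (w - z) < r -> Cmod (f n w) <= e n) ->
  (forall n, Cmod (f' n) <= e n) ->
  (forall n w, Cmod (w - z) < r ->
     Cmod (f n w - f n z - (w - z) * f' n) <= c n * Cmod (w - z) ^ 2) ->
  @is_derive C_AbsRing C_NormedModule (fun w => CSeries (fun n => f n w)) z (CSeries f').
Proof.
  intros Hr Hc He Hf Hf' Hq.
  apply (is_derive_quadratic_remainder _ _ _ r (Series c)); auto.
  intros w Hw.
  assert (Hz : Cmod (z - z) < r) by (replace (z - z)%C with (RtoC 0) by ring; now rewrite Cmod_0).
  assert (Hc0 : forall n, 0 <= c n * Cmod (w - z) ^ 2).
  { intros n. eapply Rle_trans; [apply Cmod_ge_0|apply (Hq n w Hw)]. }
  assert (Hcs : ex_series (fun n => c n * Cmod (w - z) ^ 2)) by now apply ex_series_scal_r.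
  replace (CSeries (fun n => f n w) - CSeries (fun n => f n z) - (w - z) * CSeries f')%C
    with (CSeries (fun n => f n w + ((-(1)) * f n z + (- (w - z)) * f' n))%C).
  - apply (Cmod_CSeries_le _ (fun n => c n * Cmod (w - z) ^ 2)); auto.
    + intros n. eapply Rle_trans; [|apply (Hq n w Hw)]. right; f_equal; ring.
    + intros N. rewrite <- Series_scal_r. now apply psum_le_Series.
  - assert (E : forall a g, (forall n, Cmod (g n) <= e n) ->
       forall n, Cmod (a * g n)%C <= Cmod a * e n).
    { intros a g Hg n. rewrite Cmod_mult. apply Rmult_le_compat_l; auto. apply Cmod_ge_0. }
    assert (S1 : forall a, ex_series (fun n => a * e n)) by
      (intros a; now apply (ex_series_scal (K:=R_AbsRing) (V:=R_NormedModule) a)).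
    rewrite (CSeries_plus _ _ e (fun n => Cmod (-(1)) * e n + Cmod (-(w-z)) * e n)); auto.
    + rewrite (CSeries_plus _ _ _ _ (E (-(1))%C (fun n => f n z) (fun n => Hf n z Hz)) (S1 _) (E (-(w-z))%C _ Hf') (S1 _)).
      rewrite (CSeries_scal _ _ e), (CSeries_scal _ _ e); auto. ring.
    + intros n. eapply Rle_trans; [apply Cmod_triangle|]. apply Rplus_le_compat.
      apply (E (-(1))%C (fun n => f n z)); auto. apply (E (-(w-z))%C); auto.
    + apply (ex_series_plus (K:=R_AbsRing) (V:=R_NormedModule)); auto.
Qed.

(** * Interpolation by a perturbed diagonal system *)

(** A quasi-distance, comparable to [Cmod (a - b)] plus the distances of both points to the circle;
    on the diagonal it equals [1 - Cmod a ^ 2], not 0. *)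
Definition dst (a b : C) : R := Cmod (1 - Cconj a * b).

(** A squared Cauchy kernel normalised to be 1 at [w = a]. On the unit circle its modulus is
    [1 - Cmod a ^ 2] times the Poisson kernel, which is why sums over disjoint arcs will stay
    bounded. *)
Definition ker (a w : C) : C := (RtoC (1 - Cmod a ^ 2) / (1 - Cconj a * w)) ^ 2.

Definition kerm (a w : C) : R := ((1 - Cmod a ^ 2) / dst a w) ^ 2.

Lemma Cmod_minus_ge (x y : C) : Cmod x - Cmod y <= Cmod (x - y).
Proof.
  assert (H := Cmod_triangle (x - y) y).
  replace (x - y + y)%C with x in H by ring. lra.
Qed.

Lemma dst_ge_rad a b R0 : Cmod a <= 1 -> Cmod b <= R0 -> 1 - R0 <= dst a b.
Proof.
  intros Ha Hb. unfold dst.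
  assert (H := Cmod_minus_ge 1 (Cconj a * b)%C).
  rewrite Cmod_1, Cmod_mult, Cmod_conj in H.
  assert (H1 := Cmod_ge_0 a). assert (H2 := Cmod_ge_0 b). nra.
Qed.

Lemma dst_sym a b : dst a b = dst b a.
Proof.
  unfold dst. rewrite <- Cmod_conj. f_equal.
  rewrite Cminus_conj, Cmult_conj, Cconj_conj.
  replace (Cconj 1) with (RtoC 1). ring.
  unfold Cconj; simpl. apply injective_projections; simpl; ring.
Qed.

Lemma dst_ge a b : Cmod a < 1 -> Cmod b < 1 -> 1 - Cmod a <= dst a b.
Proof. intros Ha Hb. rewrite dst_sym. apply dst_ge_rad; lra. Qed.

Lemma dst_pos a b : Cmod a < 1 -> Cmod b < 1 -> 0 < dst a b.
Proof. intros Ha Hb. assert (H := dst_ge a b Ha Hb). lra. Qed.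

Lemma dst_le_2 a b : Cmod a < 1 -> Cmod b < 1 -> dst a b <= 2.
Proof.
  intros Ha Hb. unfold dst. eapply Rle_trans; [apply Cmod_triangle|].
  rewrite Cmod_opp, Cmod_1, Cmod_mult, Cmod_conj.
  assert (H1 := Cmod_ge_0 a). assert (H2 := Cmod_ge_0 b). nra.
Qed.

(** Write [c - b] as [c * (1 - Cconj c * b) - (1 - Cmod c ^ 2) * b]; the second term costs at most
    [2 * (1 - Cmod c)], hence twice [dst c b]. *)
Lemma Cminus_le_dst c b : Cmod c < 1 -> Cmod b < 1 -> Cmod (c - b) <= 3 * dst c b.
Proof.
  intros Hc Hb.
  replace (c - b)%C with (c * (1 - Cconj c * b) - (1 - c * Cconj c) * b)%C by ring.
  rewrite <- Cmod2_conj.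
  eapply Rle_trans; [apply Cmod_triangle|]. rewrite Cmod_opp, !Cmod_mult.
  replace (1 - RtoC (Cmod c ^ 2))%C with (RtoC (1 - Cmod c ^ 2)) by (rewrite RtoC_minus; reflexivity).
  rewrite Cmod_R. assert (H1 := Cmod_ge_0 c). assert (H2 := Cmod_ge_0 b).
  rewrite Rabs_pos_eq by nra. fold (dst c b).
  assert (H := dst_ge c b Hc Hb).
  assert (Cmod c * dst c b <= dst c b) by nra.
  assert (H3 : 0 <= 1 - Cmod c ^ 2 <= 2 * (1 - Cmod c)) by nra.
  assert ((1 - Cmod c ^ 2) * Cmod b <= 1 - Cmod c ^ 2) by nra. lra.
Qed.

Lemma dst_quasi_triangle a b c : Cmod a < 1 -> Cmod b < 1 -> Cmod c < 1 ->
  dst a b <= dst a c + 3 * dst c b.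
Proof.
  intros Ha Hb Hc. unfold dst at 1.
  replace (1 - Cconj a * b)%C with ((1 - Cconj a * c) + Cconj a * (c - b))%C by ring.
  eapply Rle_trans; [apply Cmod_triangle|]. fold (dst a c).
  rewrite Cmod_mult, Cmod_conj. assert (H := Cminus_le_dst c b Hc Hb).
  assert (H1 := Cmod_ge_0 a). assert (H2 := Cmod_ge_0 (c - b)). nra.
Qed.

Lemma dst_nz a w : Cmod a < 1 -> Cmod w < 1 -> (1 - Cconj a * w)%C <> 0%C.
Proof. intros Ha Hw. apply Cmod_gt_0. now apply dst_pos. Qed.

Lemma Cmod_ker a w : Cmod a < 1 -> Cmod w < 1 -> Cmod (ker a w) = kerm a w.
Proof.
  intros Ha Hw. unfold ker, kerm. rewrite Cmod_pow, Cmod_div by now apply dst_nz.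
  rewrite Cmod_R, Rabs_pos_eq. reflexivity.
  assert (H := Cmod_ge_0 a). nra.
Qed.

Lemma kerm_nonneg a w : 0 <= kerm a w.
Proof. apply pow2_ge_0. Qed.

Lemma ker_diag a : Cmod a < 1 -> ker a a = 1.
Proof.
  intros Ha. unfold ker. replace (1 - Cconj a * a)%C with (RtoC (1 - Cmod a ^ 2)).
  - assert (H : RtoC (1 - Cmod a ^ 2) <> 0).
    { intros h. apply RtoC_inj in h. assert (H := Cmod_ge_0 a). nra. }
    replace (RtoC (1 - Cmod a ^ 2) / RtoC (1 - Cmod a ^ 2))%C with (RtoC 1) by (field; exact H).
    apply Cpow_1_l.
  - rewrite RtoC_minus, Cmod2_conj. ring.
Qed.

Lemma kerm_diag a : Cmod a < 1 -> kerm a a = 1.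
Proof. intros Ha. rewrite <- Cmod_ker, ker_diag by auto. apply Cmod_1. Qed.

(** The quasi-triangle inequality gives [dst a b <= 4 * dst a w], and the kernel is quadratic in the
    inverse distance. *)
Lemma kerm_quasi a b w : Cmod a < 1 -> Cmod b < 1 -> Cmod w < 1 ->
  dst b w <= dst a w -> kerm a w <= 16 * kerm a b.
Proof.
  intros Ha Hb Hw H. unfold kerm.
  assert (Hq := dst_quasi_triangle a b w Ha Hb Hw). rewrite (dst_sym w b) in Hq.
  assert (H1 := dst_pos a w Ha Hw). assert (H2 := dst_pos a b Ha Hb).
  assert (H3 : / dst a w <= 4 * / dst a b).
  { apply (Rmult_le_reg_l (dst a w)); auto. rewrite Rinv_r by lra.
    apply (Rmult_le_reg_r (dst a b)); auto.
    replace (dst a w * (4 * / dst a b) * dst a b) with (4 * dst a w) by (field; lra). lra. }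
  assert (H4 := Rinv_0_lt_compat _ H1).
  assert (H5 : (/ dst a w) ^ 2 <= 16 * (/ dst a b) ^ 2) by nra.
  unfold Rdiv. rewrite !Rpow_mult_distr.
  assert (H6 := pow2_ge_0 (1 - Cmod a ^ 2)). nra.
Qed.

Lemma exists_argmin (f : nat -> R) N : (0 < N)%nat ->
  exists m, (m < N)%nat /\ forall n, (n < N)%nat -> f m <= f n.
Proof.
  induction N as [|N IH]; [lia|]. intros _.
  destruct N as [|N].
  - exists 0%nat. split; [lia|]. intros n Hn. replace n with 0%nat by lia. lra.
  - destruct IH as (m & Hm & H); [lia|].
    destruct (Rle_dec (f m) (f (S N))) as [h|h].
    + exists m. split; [lia|]. intros n Hn.
      destruct (PeanoNat.Nat.eq_dec n (S N)) as [->|]; auto. apply H; lia.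
    + exists (S N). split; [lia|]. intros n Hn.
      destruct (PeanoNat.Nat.eq_dec n (S N)) as [->|]; [lra|].
      specialize (H n ltac:(lia)). lra.
Qed.

(* Comparison with the point [z m] nearest to [w] transfers the row-sum bound from the sequence to the disc. *)
Lemma kerm_sum_disc (z : nat -> C) K : (forall n, Cmod (z n) < 1) -> 0 <= K ->
  (forall m N, psum (fun n => kerm (z n) (z m)) N <= K) ->
  forall w N, Cmod w < 1 -> psum (fun n => kerm (z n) w) N <= 16 * K.
Proof.
  intros Hz HK H w N Hw. destruct N as [|N]; [unfold psum; simpl; lra|].
  destruct (exists_argmin (fun n => dst (z n) w) (S N)) as (m & Hm & Hmin); [lia|].
  apply Rle_trans with (psum (fun n => 16 * kerm (z n) (z m)) (S N)).
  - apply lsum_le. intros n Hn. apply in_seq in Hn. apply kerm_quasi; auto. apply Hmin; lia.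
  - unfold psum. rewrite lsum_scal. apply Rmult_le_compat_l; [lra|]. apply H.
Qed.

(** With [u0 = u + t], the first-order Taylor remainder of the inverse square at [u0] is exactly
    [t ^ 2 * (3 * u + t) / (u ^ 2 * u0 ^ 3)]. The constant 10 is 3 times 2 for [u] plus 4 for
    [t]. *)
Lemma ker_remainder a z w s : 0 < s -> Cmod a < 1 -> Cmod z < 1 -> Cmod w < 1 ->
  s <= dst a z -> s <= dst a w ->
  Cmod (ker a w - ker a z -
    (w - z) * (RtoC ((1 - Cmod a ^ 2) ^ 2) * (2 * Cconj a) / (1 - Cconj a * z) ^ 3))
  <= (1 - Cmod a ^ 2) ^ 2 * (10 / s ^ 5) * Cmod (w - z) ^ 2.
Proof.
  intros Hs Ha Hz Hw Hdz Hdw.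
  assert (Nz := dst_nz a z Ha Hz). assert (Nw := dst_nz a w Ha Hw).
  set (u := (1 - Cconj a * w)%C) in *. set (u0 := (1 - Cconj a * z)%C) in *.
  set (t := (Cconj a * (w - z))%C).
  replace (ker a w - ker a z - (w - z) * (RtoC ((1 - Cmod a ^ 2) ^ 2) * (2 * Cconj a) / u0 ^ 3))%C
    with (RtoC ((1 - Cmod a ^ 2) ^ 2) * (t ^ 2 * (3 * u + t) / (u ^ 2 * u0 ^ 3)))%C.
  - rewrite !Cmod_mult, Cmod_R, Rabs_pos_eq by apply pow2_ge_0.
    rewrite Rmult_assoc. apply Rmult_le_compat_l; [apply pow2_ge_0|].
    assert (N5 : (u ^ 2 * u0 ^ 3)%C <> 0%C).
    { apply Cmult_neq_0; apply Cpow_nz; auto. }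
    rewrite Cmod_div by exact N5.
    rewrite !Cmod_mult, !Cmod_pow.
    assert (Hu : Cmod u = dst a w) by reflexivity. assert (Hu0 : Cmod u0 = dst a z) by reflexivity.
    assert (Hu2 := dst_le_2 a w Ha Hw). assert (Hu02 := dst_le_2 a z Ha Hz).
    assert (Ht : Cmod t <= Cmod (w - z)).
    { unfold t. rewrite Cmod_mult, Cmod_conj. assert (H1 := Cmod_ge_0 (w - z)). nra. }
    assert (Ht4 : Cmod t <= 4).
    { replace t with (u0 - u)%C by (unfold t, u0, u; ring).
      eapply Rle_trans; [apply Cmod_triangle|]. rewrite Cmod_opp. lra. }
    assert (Hn : Cmod (3 * u + t) <= 10).
    { eapply Rle_trans; [apply Cmod_triangle|]. rewrite Cmod_mult, Cmod_R, Rabs_pos_eq by lra. lra. }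
    assert (Hd : s ^ 5 <= Cmod u ^ 2 * Cmod u0 ^ 3).
    { replace (s ^ 5) with (s ^ 2 * s ^ 3) by ring. rewrite Hu, Hu0.
      apply Rmult_le_compat; try (apply pow_le; lra); apply pow_incr; lra. }
    assert (H5 : 0 < s ^ 5) by now apply pow_lt.
    unfold Rdiv.
    replace (10 * / s ^ 5 * Cmod (w - z) ^ 2) with ((Cmod (w - z) ^ 2 * 10) * / s ^ 5) by ring.
    apply Rmult_le_compat.
    + apply Rmult_le_pos. apply pow2_ge_0. apply Cmod_ge_0.
    + apply Rlt_le, Rinv_0_lt_compat. lra.
    + apply Rmult_le_compat; auto. apply pow2_ge_0. apply Cmod_ge_0. apply pow_incr. split; auto. apply Cmod_ge_0.
    + apply Rinv_le_contravar; auto.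
  - unfold ker. fold u u0. replace t with (u0 - u)%C by (unfold t, u0, u; ring).
    replace ((w - z) * (RtoC ((1 - Cmod a ^ 2) ^ 2) * (2 * Cconj a) / u0 ^ 3))%C with
      (RtoC ((1 - Cmod a ^ 2) ^ 2) * (2 * (u0 - u)) / u0 ^ 3)%C by (unfold u; fold u0; unfold u0; field; exact Nz).
    rewrite RtoC_pow. set (q := RtoC (1 - Cmod a ^ 2)). field. auto.
Qed.

(** Since [dst] is at most 2, each squared radius is at most 4 times the kernel at the fixed point
    [z 0], and one row sum suffices. *)
Lemma ex_series_radii (z : nat -> C) K : (forall n, Cmod (z n) < 1) ->
  (forall N, psum (fun n => kerm (z n) (z 0%nat)) N <= K) ->
  ex_series (fun n => (1 - Cmod (z n) ^ 2) ^ 2).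
Proof.
  intros Hz H. apply (ex_series_psum_bounded _ (4 * K)).
  - intros; apply pow2_ge_0.
  - intros N. apply Rle_trans with (psum (fun n => 4 * kerm (z n) (z 0%nat)) N).
    + apply lsum_le. intros n _. unfold kerm.
      assert (H1 := dst_pos _ _ (Hz n) (Hz 0%nat)). assert (H2 := dst_le_2 _ _ (Hz n) (Hz 0%nat)).
      assert (H3 : / 2 <= / dst (z n) (z 0%nat)) by (apply Rinv_le_contravar; lra).
      unfold Rdiv. rewrite Rpow_mult_distr.
      assert (H6 := pow2_ge_0 (1 - Cmod (z n) ^ 2)).
      assert (H7 : 1 <= 4 * (/ dst (z n) (z 0%nat)) ^ 2) by nra. nra.
    + unfold psum. rewrite lsum_scal. apply Rmult_le_compat_l; [lra|apply H].
Qed.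

Lemma csum_off_diagonal (c g : nat -> C) K m N : (m < N)%nat -> (forall n, Cmod (c n) <= K) ->
  Cmod (csum (fun n => c n * g n)%C N - c m * g m) <= K * (psum (fun n => Cmod (g n)) N - Cmod (g m)).
Proof.
  intros Hm Hc.
  assert (T : forall n, Cmod (c n * g n) <= K * Cmod (g n)).
  { intros n. rewrite Cmod_mult. apply Rmult_le_compat_r; auto. apply Cmod_ge_0. }
  induction N as [|N IH]; [lia|]. rewrite csum_S, psum_S.
  destruct (PeanoNat.Nat.eq_dec m N) as [->|Hne].
  - replace (csum (fun n => (c n * g n)%C) N + c N * g N - c N * g N)%C with
      (csum (fun n => (c n * g n)%C) N) by ring.
    eapply Rle_trans; [apply Cmod_csum_le|].
    replace (K * (psum (fun n => Cmod (g n)) N + Cmod (g N) - Cmod (g N)))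
      with (psum (fun n => K * Cmod (g n)) N) by (unfold psum; rewrite lsum_scal; ring).
    apply lsum_le; auto.
  - replace (csum (fun n => (c n * g n)%C) N + c N * g N - c m * g m)%C with
      ((csum (fun n => (c n * g n)%C) N - c m * g m) + c N * g N)%C by ring.
    eapply Rle_trans; [apply Cmod_triangle|]. specialize (IH ltac:(lia)). specialize (T N). lra.
Qed.

Section Interpolation.

Variable z : nat -> C.
Hypothesis Hz : forall n, Cmod (z n) < 1.
Hypothesis Hrow : forall m N, psum (fun n => kerm (z n) (z m)) N <= 5 / 4.

Lemma kerm_ex_series w : Cmod w < 1 -> ex_series (fun n => kerm (z n) w).
Proof.
  intros Hw. apply (ex_series_psum_bounded _ (16 * (5/4))). intros; apply kerm_nonneg.
  intros N. apply kerm_sum_disc; auto. lra.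
Qed.

Lemma ker_comb_dominated c K w : Cmod w < 1 -> (forall n, Cmod (c n) <= K) ->
  forall n, Cmod (c n * ker (z n) w) <= K * kerm (z n) w.
Proof.
  intros Hw Hc n. rewrite Cmod_mult, Cmod_ker by auto.
  apply Rmult_le_compat_r; auto. apply kerm_nonneg.
Qed.

Lemma ker_comb_ex_series K w : Cmod w < 1 -> ex_series (fun n => K * kerm (z n) w).
Proof.
  intros Hw. apply (ex_series_scal (K:=R_AbsRing) (V:=R_NormedModule) K). now apply kerm_ex_series.
Qed.

(** The diagonal entry is 1, so a row sum of at most 5/4 leaves at most 1/4 off the diagonal. *)
Lemma ker_comb_almost_diagonal c K m : (forall n, Cmod (c n) <= K) ->
  Cmod (c m - CSeries (fun n => c n * ker (z n) (z m))%C) <= K / 4.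
Proof.
  intros Hc. rewrite <- Cmod_opp.
  replace (- (c m - CSeries (fun n => c n * ker (z n) (z m))))%C
    with (CSeries (fun n => c n * ker (z n) (z m)) - c m)%C by ring.
  (* Only partial sums of length at least [S m] contain the diagonal term. *)
  apply (CSeries_in_ball _ (fun n => K * kerm (z n) (z m)) _ _ (S m)).
  - now apply ker_comb_dominated.
  - now apply ker_comb_ex_series.
  - intros N HN.
    assert (H := csum_off_diagonal c (fun n => ker (z n) (z m)) K m N ltac:(lia) Hc).
    cbv beta in H. rewrite ker_diag, Cmod_1, Cmult_1_r in H by auto.
    eapply Rle_trans; [exact H|].
    replace (psum (fun n => Cmod (ker (z n) (z m))) N) with (psum (fun n => kerm (z n) (z m)) N).
    + assert (h := Hrow m N). assert (h0 := Cmod_ge_0 (c 0%nat)). specialize (Hc 0%nat). nra.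
    + apply lsum_ext. intros n _. now rewrite Cmod_ker.
Qed.

Lemma ker_comb_bounded c K w : Cmod w < 1 -> (forall n, Cmod (c n) <= K) ->
  Cmod (CSeries (fun n => c n * ker (z n) w)%C) <= 20 * K.
Proof.
  intros Hw Hc. apply (Cmod_CSeries_le _ (fun n => K * kerm (z n) w)).
  - now apply ker_comb_dominated.
  - now apply ker_comb_ex_series.
  - intros N. unfold psum. rewrite lsum_scal.
    assert (h : psum (fun n => kerm (z n) w) N <= 16 * (5/4)) by (apply kerm_sum_disc; auto; lra).
    assert (h0 := Cmod_ge_0 (c 0%nat)). specialize (Hc 0%nat). unfold psum in h. nra.
Qed.

Lemma ker_comb_holomorphic c K : (forall n, Cmod (c n) <= K) ->
  holomorphic_on_disc (fun w => CSeries (fun n => c n * ker (z n) w)%C).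
Proof.
  intros Hc x Hx. set (s := (1 - Cmod x) / 2). assert (Hs : 0 < s) by (unfold s; lra).
  set (q := fun n => (1 - Cmod (z n) ^ 2) ^ 2).
  assert (Hq : ex_series q) by (apply (ex_series_radii z (5/4)); auto).
  assert (Hq0 : forall n, 0 <= q n) by (intros; apply pow2_ge_0).
  assert (HK : 0 <= K) by (assert (h0 := Cmod_ge_0 (c 0%nat)); specialize (Hc 0%nat); lra).
  set (g' := fun n => (RtoC ((1 - Cmod (z n) ^ 2) ^ 2) * (2 * Cconj (z n)) / (1 - Cconj (z n) * x) ^ 3)%C).
  assert (Hball : forall w, Cmod (w - x) < s -> Cmod w < 1 /\ forall n, s <= dst (z n) w).
  { intros w Hw. assert (h := Cmod_minus_ge w x). assert (Cmod w < 1 - s) by (unfold s in *; lra).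
    split; [lra|]. intros n. assert (h1 := dst_ge_rad (z n) w (1 - s)). specialize (Hz n).
    replace s with (1 - (1 - s)) by ring. apply h1; lra. }
  assert (Hx0 : forall n, s <= dst (z n) x).
  { apply Hball. replace (x - x)%C with (RtoC 0) by ring. now rewrite Cmod_0. }
  exists (CSeries (fun n => c n * g' n)%C).
  assert (H2 : 0 < / s ^ 2) by now apply Rinv_0_lt_compat, pow_lt.
  assert (H3 : 0 < / s ^ 3) by now apply Rinv_0_lt_compat, pow_lt.
  apply (is_derive_CSeries (fun n w => c n * ker (z n) w)%C _ x s
    (fun n => q n * (K * (10 / s ^ 5))) (fun n => q n * (K * (/ s ^ 2 + 2 * / s ^ 3)))); auto.
  - now apply ex_series_scal_r.
  - now apply ex_series_scal_r.
  - intros n w Hw. destruct (Hball w Hw) as [Hw1 Hsw]. specialize (Hsw n).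
    rewrite Cmod_mult, Cmod_ker by auto. unfold kerm, Rdiv. rewrite Rpow_mult_distr. fold (q n).
    assert (h : (/ dst (z n) w) ^ 2 <= / s ^ 2).
    { rewrite pow_inv. apply Rinv_le_contravar. now apply pow_lt. apply pow_incr; lra. }
    assert (h1 := pow2_ge_0 (/ dst (z n) w)).
    apply Rle_trans with (K * (q n * / s ^ 2)).
    + apply Rmult_le_compat; auto. apply Cmod_ge_0. apply Rmult_le_pos; auto. apply Rmult_le_compat_l; auto.
    + assert (0 <= K * q n) by now apply Rmult_le_pos. nra.
  - intros n. rewrite Cmod_mult. unfold g'.
    rewrite Cmod_div by (apply Cpow_nz, dst_nz; auto).
    rewrite !Cmod_mult, Cmod_R, Rabs_pos_eq, Cmod_pow by apply Hq0.
    rewrite Cmod_R, Rabs_pos_eq, Cmod_conj by lra. fold (q n). fold (dst (z n) x).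
    assert (h : / dst (z n) x ^ 3 <= / s ^ 3).
    { apply Rinv_le_contravar. now apply pow_lt. apply pow_incr; split; [lra|apply Hx0]. }
    assert (h1 : 0 < / dst (z n) x ^ 3) by (apply Rinv_0_lt_compat, pow_lt, dst_pos; auto).
    assert (h2 := Hz n). assert (h3 := Cmod_ge_0 (z n)).
    apply Rle_trans with (K * (q n * 2 * / s ^ 3)).
    + apply Rmult_le_compat; auto. apply Cmod_ge_0.
      * unfold Rdiv. apply Rmult_le_pos; [apply Rmult_le_pos; [apply Hq0|lra]|lra].
      * unfold Rdiv. apply Rmult_le_compat; auto; try lra.
        -- apply Rmult_le_pos; [apply Hq0|lra].
        -- apply Rmult_le_compat_l; [apply Hq0|lra].
    + assert (0 <= K * q n) by now apply Rmult_le_pos. nra.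
  - intros n w Hw. destruct (Hball w Hw) as [Hw1 Hsw]. specialize (Hsw n).
    replace (c n * ker (z n) w - c n * ker (z n) x - (w - x) * (c n * g' n))%C
      with (c n * (ker (z n) w - ker (z n) x - (w - x) * g' n))%C by ring.
    rewrite Cmod_mult.
    assert (h := ker_remainder (z n) x w s Hs (Hz n) Hx Hw1 (Hx0 n) Hsw). fold (g' n) (q n) in h.
    apply Rle_trans with (K * (q n * (10 / s ^ 5) * Cmod (w - x) ^ 2)).
    + apply Rmult_le_compat; auto; apply Cmod_ge_0.
    + right; ring.
Qed.

(* Neumann series for the operator [c |-> (fun m => sum_n c n * ker (z n) (z m))], which is within 1/4 of the identity on bounded sequences. *)
Fixpoint residual (w : nat -> C) (i m : nat) : C :=
  match i with
  | O => w m
  | S i => (residual w i m - CSeries (fun n => residual w i n * ker (z n) (z m)))%C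
  end.

Lemma residual_bound w M i m : (forall n, Cmod (w n) <= M) -> Cmod (residual w i m) <= M / 4 ^ i.
Proof.
  intros Hw. revert m. induction i as [|i IH]; intros m; simpl.
  - replace (M / 1) with M by field. apply Hw.
  - eapply Rle_trans; [apply (ker_comb_almost_diagonal (residual w i) (M / 4 ^ i) m IH)|].
    right. field. apply pow_nonzero; lra.
Qed.

(** The right-hand side is the exact geometric sum of the residual bounds from [I] to [N - 1], so
    the induction closes. *)
Lemma residual_csum_bound w M I N m : (forall n, Cmod (w n) <= M) -> (I <= N)%nat ->
  Cmod (csum (fun i => residual w i m) N - csum (fun i => residual w i m) I)
  <= 4 / 3 * (M / 4 ^ I - M / 4 ^ N).
Proof.
  intros Hw. induction 1 as [|N _ IH].
  - replace (csum (fun i => residual w i m) I - csum (fun i => residual w i m) I)%C with (RtoC 0) by ring.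
    rewrite Cmod_0; lra.
  - rewrite csum_S.
    replace (csum (fun i => residual w i m) N + residual w N m - csum (fun i => residual w i m) I)%C with
      ((csum (fun i => residual w i m) N - csum (fun i => residual w i m) I) + residual w N m)%C by ring.
    eapply Rle_trans; [apply Cmod_triangle|].
    assert (h := residual_bound w M N m Hw).
    replace (M / 4 ^ S N) with (M / 4 ^ N / 4) by (simpl; field; apply pow_nonzero; lra). lra.
Qed.

(** The operator sends the [i]-th residual to the difference of residuals [i] and [S i], so the
    images telescope. *)
Lemma residual_partial_solution w M I m : (forall n, Cmod (w n) <= M) ->
  CSeries (fun n => csum (fun i => residual w i n) I * ker (z n) (z m))%C = (w m - residual w I m)%C.
Proof.
  intros Hw. assert (HM : 0 <= M) by (eapply Rle_trans; [apply Cmod_ge_0|apply (Hw 0%nat)]).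
  induction I as [|I IH].
  - simpl. rewrite (CSeries_ext _ (fun _ => 0 * 0)%C).
    + rewrite (CSeries_scal 0 (fun _ => 0%C) (fun _ => 0)). ring.
      intros _; rewrite Cmod_0; lra.
      apply (ex_series_psum_bounded _ 0). intros; lra.
      intros N. unfold psum; rewrite lsum_const; lra.
    + intros n. change (csum (fun i => residual w i n) 0) with (RtoC 0). ring.
  - rewrite (CSeries_ext _ (fun n => csum (fun i => residual w i n) I * ker (z n) (z m)
                               + residual w I n * ker (z n) (z m))%C).
    + assert (B : forall n, Cmod (csum (fun i => residual w i n) I) <= 4/3 * M).
      { intros n. assert (h := residual_csum_bound w M 0 I n Hw ltac:(lia)).
        change (csum (fun i => residual w i n) 0) with (RtoC 0) in h.
        replace (csum (fun i => residual w i n) I - 0)%C with (csum (fun i => residual w i n) I) in h by ring.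
        assert (h1 : 0 <= M / 4 ^ I) by (apply Rdiv_le_0_compat; auto; apply pow_lt; lra).
        rewrite pow_O, Rdiv_1_r in h. lra. }
      rewrite (CSeries_plus _ _ (fun n => 4/3*M * kerm (z n) (z m)) (fun n => M / 4 ^ I * kerm (z n) (z m))).
      * rewrite IH. simpl. ring.
      * apply ker_comb_dominated; auto.
      * now apply ker_comb_ex_series.
      * apply ker_comb_dominated; auto. intros n. now apply residual_bound.
      * now apply ker_comb_ex_series.
    + intros n. rewrite csum_S. ring.
Qed.

Lemma Cmod_le_geometric (x : C) K : (forall I, Cmod x <= K / 4 ^ I) -> x = 0%C.
Proof.
  intros H. apply Cmod_eq_0. apply Rle_antisym; [|apply Cmod_ge_0].
  assert (L : is_lim_seq (fun I => K * (/ 4) ^ I) (K * 0)).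
  { apply is_lim_seq_mult'. apply is_lim_seq_const. apply is_lim_seq_geom. rewrite Rabs_pos_eq; lra. }
  rewrite Rmult_0_r in L.
  refine (is_lim_seq_le (fun _ => Cmod x) _ (Cmod x) 0 _ (is_lim_seq_const _) L).
  intros I. rewrite pow_inv. apply H.
Qed.

Lemma interpolating_of_row_sums : interpolating z.
Proof.
  split; [exact Hz|]. intros w (M & Hw).
  assert (HM : 0 <= M) by (eapply Rle_trans; [apply Cmod_ge_0|apply (Hw 0%nat)]).
  set (v := fun n => CSeries (fun i => residual w i n)).
  assert (Hgeo : ex_series (fun i => M / 4 ^ i)).
  { apply (ex_series_ext (fun i => (/ 4) ^ i * M)).
    - intros i. rewrite pow_inv. unfold Rdiv. apply Rmult_comm.
    - apply ex_series_scal_r, ex_series_geom. rewrite Rabs_pos_eq; lra. }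
  assert (Hv : forall n I, Cmod (v n - csum (fun i => residual w i n) I) <= 4/3 * M / 4 ^ I).
  { intros n I. apply (CSeries_in_ball _ (fun i => M / 4 ^ i) _ _ I); auto.
    - intros i. now apply residual_bound.
    - intros N HN. eapply Rle_trans; [apply (residual_csum_bound w M I N n Hw HN)|].
      assert (h1 : 0 <= M / 4 ^ N) by (apply Rdiv_le_0_compat; auto; apply pow_lt; lra).
      unfold Rdiv in *. lra. }
  assert (Hv0 : forall n, Cmod (v n) <= 4/3 * M).
  { intros n. specialize (Hv n 0%nat). change (csum (fun i => residual w i n) 0) with (RtoC 0) in Hv.
    replace (v n - 0)%C with (v n) in Hv by ring.
    rewrite pow_O, Rdiv_1_r in Hv. exact Hv. }
  exists (fun x => CSeries (fun n => v n * ker (z n) x)%C). split; [split|].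
  - now apply (ker_comb_holomorphic v (4/3 * M)).
  - exists (20 * (4/3 * M)). intros x Hx. now apply ker_comb_bounded.
  (* For each [I] the error equals the image of the tail [d] minus the [I]-th residual. Both are of
     order [4 ^ -I], which forces it to vanish. *)
  - intros m. cut ((CSeries (fun n => v n * ker (z n) (z m)) - w m)%C = 0%C).
    { intros h. rewrite <- (Cplus_0_l (w m)), <- h. ring. }
    apply (Cmod_le_geometric _ (20 * (4/3 * M) + M)). intros I.
    set (d := fun n => (v n - csum (fun i => residual w i n) I)%C).
    replace (CSeries (fun n => v n * ker (z n) (z m)) - w m)%C
      with (CSeries (fun n => d n * ker (z n) (z m)) - residual w I m)%C.
    + eapply Rle_trans; [apply Cmod_triangle|]. rewrite Cmod_opp.
      assert (h1 := ker_comb_bounded d (4/3 * M / 4 ^ I) (z m) (Hz m) (fun n => Hv n I)).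
      assert (h2 := residual_bound w M I m Hw). unfold Rdiv in *. lra.
    + rewrite (CSeries_ext _ (fun n => v n * ker (z n) (z m) +
         (-(1)) * (csum (fun i => residual w i n) I * ker (z n) (z m)))%C) by (intros; unfold d; ring).
      assert (B : forall n, Cmod (csum (fun i => residual w i n) I) <= 4/3 * M + 4/3 * M / 4 ^ I).
      { intros n. replace (csum (fun i => residual w i n) I) with (v n - d n)%C by (unfold d; ring).
        eapply Rle_trans; [apply Cmod_triangle|]. rewrite Cmod_opp. apply Rplus_le_compat; auto. apply Hv. }
      rewrite (CSeries_plus _ _ (fun n => 4/3*M * kerm (z n) (z m))
                 (fun n => (4/3*M + 4/3 * M / 4 ^ I) * kerm (z n) (z m))).
      * rewrite (CSeries_scal _ _ (fun n => (4/3*M + 4/3 * M / 4 ^ I) * kerm (z n) (z m))).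
        -- rewrite (residual_partial_solution w M) by auto. ring.
        -- now apply ker_comb_dominated.
        -- now apply ker_comb_ex_series.
      * now apply ker_comb_dominated.
      * now apply ker_comb_ex_series.
      * intros n. rewrite Cmod_mult, Cmod_opp, Cmod_1, Rmult_1_l.
        now apply (ker_comb_dominated (fun n => csum (fun i => residual w i n) I)).
      * now apply ker_comb_ex_series.
Qed.

End Interpolation.

(** * Lacunary cosine sums at 4-adic points *)

Definition walk (n : nat) (x : R) : R := psum (fun i => cos (2 * PI * (4 ^ i * x))) n.

(** Sampling the [n]-step walk at the points of its own scale makes probabilities finite averages
    over [k < 4 ^ n]; larger [k] are allowed by periodicity. *)
Definition walkv (n k : nat) : R := walk n (INR k / 4 ^ n).

Lemma pow4_pos n : 0 < 4 ^ n.
Proof. apply pow_lt; lra. Qed.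

Lemma INR_pow4 n : INR (4 ^ n) = 4 ^ n.
Proof. rewrite pow_INR. f_equal. simpl; ring. Qed.

Lemma cos_add_INR x k : cos (2 * PI * (x + INR k)) = cos (2 * PI * x).
Proof.
  replace (2 * PI * (x + INR k)) with (2 * PI * x + 2 * INR k * PI) by ring. apply cos_period.
Qed.

Lemma psum_ext f g n : (forall i, f i = g i) -> psum f n = psum g n.
Proof. intros H. apply lsum_ext; auto. Qed.

Lemma psum_shift f m n : psum f (m + n) = psum f m + psum (fun i => f (m + i)%nat) n.
Proof.
  induction n as [|n IH].
  - rewrite PeanoNat.Nat.add_0_r. unfold psum at 3; simpl. ring.
  - rewrite PeanoNat.Nat.add_succ_r, !psum_S, IH. ring.
Qed.

Lemma walk_add m n x : walk (m + n) x = walk m x + walk n (4 ^ m * x).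
Proof.
  unfold walk. rewrite psum_shift. f_equal. apply psum_ext. intros i.
  rewrite pow_add. do 2 f_equal. ring.
Qed.

Lemma walk_add_INR n x k : walk n (x + INR k) = walk n x.
Proof.
  unfold walk. apply psum_ext. intros i.
  rewrite Rmult_plus_distr_l, <- (INR_pow4 i), <- mult_INR. apply cos_add_INR.
Qed.

Lemma cos_lipschitz x y : Rabs (cos x - cos y) <= Rabs (x - y).
Proof.
  rewrite form2. rewrite !Rabs_mult. rewrite (Rabs_left (-2)) by lra.
  assert (S0 : forall t, Rabs (sin t) <= Rabs t).
  { assert (P : forall t, 0 <= t -> Rabs (sin t) <= t).
    { intros t Ht. destruct (Rle_dec t 1) as [h|h].
      - destruct (Req_dec t 0) as [->|h0]; [rewrite sin_0, Rabs_R0; lra|].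
        assert (h1 := sin_lt_x t ltac:(lra)). assert (h2 := PI2_1).
        rewrite Rabs_pos_eq; [lra|]. apply sin_ge_0; lra.
      - apply Rabs_le. assert (h1 := SIN_bound t). lra. }
    intros t. destruct (Rle_dec 0 t) as [h|h].
    - rewrite (Rabs_pos_eq t) by auto. auto.
    - rewrite <- (Rabs_Ropp t), <- Rabs_Ropp, <- sin_neg, (Rabs_pos_eq (-t)) by lra. apply P; lra. }
  assert (h1 := S0 ((x - y) / 2)).
  assert (h2 : Rabs (sin ((x + y) / 2)) <= 1) by (apply Rabs_le, SIN_bound).
  replace (Rabs ((x - y) / 2)) with (Rabs (x - y) / 2) in h1
    by (unfold Rdiv; rewrite Rabs_mult, (Rabs_pos_eq (/2)); lra).
  assert (h3 := Rabs_pos (sin ((x - y) / 2))). assert (h4 := Rabs_pos (sin ((x + y) / 2))). nra.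
Qed.

Lemma walk_lipschitz n x y : Rabs (walk n x - walk n y) <= 2 * PI / 3 * 4 ^ n * Rabs (x - y).
Proof.
  assert (HP := PI_RGT_0). assert (H0 := Rabs_pos (x - y)).
  (* The sharper factor [4 ^ n - 1] comes from summing the geometric series of frequencies and is
     what the induction preserves. *)
  cut (Rabs (walk n x - walk n y) <= 2 * PI / 3 * (4 ^ n - 1) * Rabs (x - y)).
  { intros H. eapply Rle_trans; [exact H|]. apply Rmult_le_compat_r; auto.
    apply Rmult_le_compat_l; lra. }
  induction n as [|n IH].
  - unfold walk, psum; simpl. rewrite Rminus_diag, Rabs_R0. lra.
  - unfold walk in *. rewrite !psum_S.
    set (a := psum (fun i => cos (2 * PI * (4 ^ i * x))) n) in *.
    set (b := psum (fun i => cos (2 * PI * (4 ^ i * y))) n) in *.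
    replace (a + cos (2 * PI * (4 ^ n * x)) - (b + cos (2 * PI * (4 ^ n * y))))
      with ((a - b) + (cos (2 * PI * (4 ^ n * x)) - cos (2 * PI * (4 ^ n * y)))) by ring.
    eapply Rle_trans; [apply Rabs_triang|].
    assert (h := cos_lipschitz (2 * PI * (4 ^ n * x)) (2 * PI * (4 ^ n * y))).
    replace (2 * PI * (4 ^ n * x) - 2 * PI * (4 ^ n * y)) with (2 * PI * 4 ^ n * (x - y)) in h by ring.
    rewrite Rabs_mult, (Rabs_pos_eq (2 * PI * 4 ^ n)) in h
      by (assert (h4 := pow4_pos n); apply Rmult_le_pos; lra).
    simpl. lra.
Qed.

(** The last [n] steps are exactly [walkv n k] by periodicity. The first [m] are evaluated within
    [4 ^ -m] of [a / 4 ^ m], and the Lipschitz bound makes the error at most [2 * PI / 3], below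
    3. *)
Lemma walkv_concat m n a k : (k < 4 ^ n)%nat ->
  walkv m a + walkv n k - 3 <= walkv (m + n) (a * 4 ^ n + k).
Proof.
  intros Hk. unfold walkv at 3. rewrite walk_add.
  assert (H4m := pow4_pos m). assert (H4n := pow4_pos n).
  set (x := INR (a * 4 ^ n + k) / 4 ^ (m + n)).
  assert (Ex : x = INR a / 4 ^ m + INR k / 4 ^ n / 4 ^ m).
  { unfold x. rewrite plus_INR, mult_INR, INR_pow4, pow_add. field. lra. }
  replace (4 ^ m * x) with (INR k / 4 ^ n + INR a) by (rewrite Ex; field; lra).
  rewrite walk_add_INR. fold (walkv n k).
  assert (H := walk_lipschitz m x (INR a / 4 ^ m)). fold (walkv m a) in H.
  assert (Hk' : 0 <= INR k / 4 ^ n <= 1).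
  { apply lt_INR in Hk. rewrite INR_pow4 in Hk. split.
    - apply Rdiv_le_0_compat; auto. apply pos_INR.
    - apply (Rmult_le_reg_r (4 ^ n)); auto. unfold Rdiv. rewrite Rmult_assoc, Rinv_l; lra. }
  replace (x - INR a / 4 ^ m) with (INR k / 4 ^ n / 4 ^ m) in H by (rewrite Ex; ring).
  rewrite Rabs_pos_eq with (x := INR k / 4 ^ n / 4 ^ m) in H by (apply Rdiv_le_0_compat; lra).
  replace (2 * PI / 3 * 4 ^ m * (INR k / 4 ^ n / 4 ^ m)) with (2 * PI / 3 * (INR k / 4 ^ n)) in H by (field; lra).
  assert (HP := PI_4). assert (HP0 := PI_RGT_0). apply Rabs_le_between in H. nra.
Qed.

Lemma walkv_ge n k : - INR n <= walkv n k.
Proof.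
  unfold walkv, walk. generalize (INR k / 4 ^ n) as x. intros x.
  induction n as [|n IH]; [unfold psum; simpl; lra|].
  rewrite psum_S, S_INR. assert (h := COS_bound (2 * PI * (4 ^ n * x))). lra.
Qed.

(** * Moments of the walk over its 4-adic points *)

Lemma psum_mul_split f a b :
  psum f (a * b) = psum (fun j => psum (fun k => f (j * b + k)%nat) b) a.
Proof.
  induction a as [|a IH]; [reflexivity|].
  rewrite psum_S, <- IH, PeanoNat.Nat.mul_succ_l. apply psum_shift.
Qed.

(** The four values [j < 4] are the preimages of [y / 4 ^ n] under multiplication by 4 modulo 1:
    they share the last [n] steps, and their first steps differ by quarter turns. *)
Lemma walkv_succ n y j :
  walkv (S n) (j * 4 ^ n + y) = cos (2 * PI * (INR y / 4 ^ S n) + INR j * (PI / 2)) + walkv n y.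
Proof.
  unfold walkv at 1. change (S n) with (1 + n)%nat at 1. rewrite walk_add.
  assert (H4n := pow4_pos n).
  set (x := INR (j * 4 ^ n + y) / 4 ^ S n).
  assert (Ex : x = INR y / 4 ^ S n + INR j / 4).
  { unfold x. rewrite plus_INR, mult_INR, INR_pow4. simpl. field. lra. }
  replace (4 ^ 1 * x) with (INR y / 4 ^ n + INR j) by (rewrite Ex; simpl; field; lra).
  rewrite walk_add_INR. unfold walkv. f_equal.
  unfold walk, psum. simpl lsum. rewrite Rplus_0_r. f_equal. rewrite Ex. simpl. field. lra.
Qed.

Lemma psum_four (f : R -> R) t v :
  psum (fun j => f (cos (t + INR j * (PI / 2)) + v)) 4
  = f (cos t + v) + f (- sin t + v) + f (- cos t + v) + f (sin t + v).
Proof.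
  unfold psum. simpl lsum.
  replace (t + 0 * (PI / 2)) with t by ring.
  replace (t + 1 * (PI / 2)) with (PI / 2 + t) by ring.
  replace (t + (1 + 1) * (PI / 2)) with (t + PI) by field.
  replace (t + (1 + 1 + 1) * (PI / 2)) with (PI / 2 + (t + PI)) by field.
  replace (cos (PI / 2 + (t + PI))) with (sin t) by (assert (h := sin_cos (t + PI)); rewrite neg_sin in h; lra).
  replace (cos (PI / 2 + t)) with (- sin t) by (assert (h := sin_cos t); lra).
  rewrite neg_cos. ring.
Qed.

Lemma psum_walkv_succ (f : R -> R) n :
  psum (fun k => f (walkv (S n) k)) (4 ^ S n)
  = psum (fun y => let t := 2 * PI * (INR y / 4 ^ S n) in
      f (cos t + walkv n y) + f (- sin t + walkv n y)
      + f (- cos t + walkv n y) + f (sin t + walkv n y)) (4 ^ n).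
Proof.
  change (4 ^ S n)%nat with (4 * 4 ^ n)%nat. rewrite psum_mul_split.
  transitivity (psum (fun y => psum (fun j =>
     f (cos (2 * PI * (INR y / 4 ^ S n) + INR j * (PI / 2)) + walkv n y)) 4) (4 ^ n)).
  - transitivity (psum (fun j => psum (fun y =>
     f (cos (2 * PI * (INR y / 4 ^ S n) + INR j * (PI / 2)) + walkv n y)) (4 ^ n)) 4).
    + apply psum_ext. intros j. apply psum_ext. intros y. now rewrite walkv_succ.
    + rewrite 4!psum_S. unfold psum at 1; simpl lsum at 1. rewrite Rplus_0_l.
      unfold psum at 1 2 3 4. rewrite <- !lsum_plus. apply lsum_ext. intros y _.
      rewrite 4!psum_S. unfold psum; simpl lsum. ring.
  - apply psum_ext. intros y. apply psum_four.
Qed.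

Lemma cos2_sin2 t : cos t * cos t + sin t * sin t = 1.
Proof. assert (h := sin2_cos2 t). unfold Rsqr in h. lra. Qed.

Lemma walkv_mean n : psum (fun k => walkv n k) (4 ^ n) = 0.
Proof.
  induction n as [|n IH].
  - unfold psum, walkv, walk, psum; simpl. ring.
  - rewrite (psum_walkv_succ (fun v => v)).
    transitivity (psum (fun y => 4 * walkv n y) (4 ^ n)).
    + apply psum_ext. intros y; cbv zeta; ring.
    + unfold psum in *. rewrite lsum_scal. replace (lsum _ _) with 0 by (symmetry; exact IH). ring.
Qed.

(** Over the four preimages the cross terms cancel and the squares of the first step sum to 2, so
    each step adds exactly 1/2 to the mean. *)
Lemma walkv_second_moment n : psum (fun k => walkv n k ^ 2) (4 ^ n) = 4 ^ n * (INR n / 2).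
Proof.
  induction n as [|n IH].
  - unfold psum, walkv, walk, psum; simpl. field.
  - rewrite (psum_walkv_succ (fun v => v ^ 2)).
    transitivity (psum (fun y => 2 + 4 * walkv n y ^ 2) (4 ^ n)).
    + apply psum_ext. intros y; cbv zeta.
      assert (h := cos2_sin2 (2 * PI * (INR y / 4 ^ S n))). nra.
    + unfold psum in *. rewrite lsum_plus, lsum_const, lsum_scal, IH, length_seq, INR_pow4, S_INR.
      simpl. field.
Qed.

(** Odd terms cancel again. Per base point the four preimages add at most [2 + 12 * v ^ 2] to
    [4 * v ^ 4]; the second moment turns this into [2 + 6 * n + 4 * n ^ 2], below
    [4 * (n + 1) ^ 2]. *)
Lemma walkv_fourth_moment n : psum (fun k => walkv n k ^ 4) (4 ^ n) <= 4 ^ n * INR n ^ 2.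
Proof.
  induction n as [|n IH].
  - unfold psum, walkv, walk, psum; simpl. lra.
  - rewrite (psum_walkv_succ (fun v => v ^ 4)).
    apply Rle_trans with (psum (fun y => 2 + (12 * walkv n y ^ 2 + 4 * walkv n y ^ 4)) (4 ^ n)).
    + apply lsum_le. intros y _; cbv zeta.
      assert (h := cos2_sin2 (2 * PI * (INR y / 4 ^ S n))).
      set (c := cos _) in *. set (s := sin _) in *. set (v := walkv n y).
      replace ((c + v) ^ 4 + (- s + v) ^ 4 + (- c + v) ^ 4 + (s + v) ^ 4)
        with (2 * (c * c * (c * c) + s * s * (s * s)) + 12 * (c * c + s * s) * v ^ 2 + 4 * v ^ 4) by ring.
      rewrite h. assert (h1 := Rle_0_sqr c). assert (h2 := Rle_0_sqr s). unfold Rsqr in *. nra.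
    + assert (h := walkv_second_moment n).
      unfold psum in *. rewrite !lsum_plus, lsum_const, !lsum_scal, h, length_seq, INR_pow4, S_INR.
      simpl (4 ^ S n). assert (h4 := pow4_pos n). assert (hn := pos_INR n). nra.
Qed.

(** * One-sided large deviations of the walk *)

Definition indic (s t : R) : R := if Rle_dec s t then 1 else 0.

Lemma indic_bounds s t : 0 <= indic s t <= 1.
Proof. unfold indic; destruct (Rle_dec s t); lra. Qed.

Definition count (n : nat) (s : R) : R := psum (fun k => indic s (walkv n k)) (4 ^ n).

(* A quartic minorant of [3 * indic (1/10)] turns the first, second and fourth moments into a lower bound for a one-sided tail. *)
Lemma indic_quartic v : v + v ^ 2 - v ^ 4 / 4 - 1 / 8 <= 3 * indic (1 / 10) v.
Proof.
  unfold indic. destruct (Rle_dec (1 / 10) v) as [h|h].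
  - assert (h1 := pow2_ge_0 (v ^ 2 / 2 - 3 / 2)). assert (h2 := pow2_ge_0 (v - 1)). simpl in *. lra.
  - destruct (Rle_dec 0 v) as [h0|h0].
    + assert (0 <= v ^ 4) by now apply pow_le. nra.
    + set (u := - v). replace v with (- u) by (unfold u; ring). assert (hu : 0 < u) by (unfold u; lra).
      (* A cubic with double root 29/25, a rational slightly above the minimum point [2 / sqrt 3] of
         [u ^ 3 - 4 * u]; it bounds [u ^ 3] below by a line of slope just over 4. *)
      assert (h1 : 0 <= (u - 29 / 25) ^ 2 * (u + 58 / 25)).
      { apply Rmult_le_pos. apply pow2_ge_0. lra. }
      assert (h2 : 0 <= u * ((u - 29 / 25) ^ 2 * (u + 58 / 25))) by (apply Rmult_le_pos; lra).
      simpl in *. nra.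
Qed.

(** After division by [sqrt n] the moments are 0, 1/2 and at most 1. The quartic minorant then has
    mean at least [1/2 - 1/4 - 1/8 = 1/8], and the factor 3 makes it 1/24. *)
Lemma count_one_sided n : (1 <= n)%nat -> 4 ^ n / 24 <= count n (sqrt (INR n) / 10).
Proof.
  intros Hn. apply le_INR in Hn. simpl in Hn.
  set (q := sqrt (INR n)). assert (Hq : 0 < q) by (apply sqrt_lt_R0; lra).
  assert (Hqq : q ^ 2 = INR n) by (unfold q; simpl; rewrite Rmult_1_r; apply sqrt_sqrt; lra).
  assert (H4 := pow4_pos n).
  assert (L : psum (fun k => (/ q) * walkv n k + ((/ q) ^ 2 * walkv n k ^ 2 +
       ((- (/ q) ^ 4 / 4) * walkv n k ^ 4 + (- (1 / 8))))) (4 ^ n)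
     <= psum (fun k => 3 * indic (q / 10) (walkv n k)) (4 ^ n)).
  { apply lsum_le. intros k _.
    assert (h := indic_quartic (walkv n k / q)).
    replace (indic (q / 10) (walkv n k)) with (indic (1 / 10) (walkv n k / q)).
    - eapply Rle_trans; [|exact h]. right. field. lra.
    - assert (e : walkv n k = q * (walkv n k / q)) by (field; lra).
      unfold indic. destruct (Rle_dec (1 / 10) (walkv n k / q)), (Rle_dec (q / 10) (walkv n k)); auto; nra. }
  assert (h1 := walkv_mean n). assert (h2 := walkv_second_moment n). assert (h4 := walkv_fourth_moment n).
  unfold count, psum in *. change (lsum (walkv n) (seq 0 (4 ^ n)) = 0) in h1.
  rewrite !lsum_plus, !lsum_scal, lsum_const, length_seq, INR_pow4, h1, h2 in L.
  assert (e2 : (/ q) ^ 2 * (4 ^ n * (INR n / 2)) = 4 ^ n / 2).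
  { rewrite <- Hqq. field. lra. }
  assert (e4 : (/ q) ^ 4 * (4 ^ n * INR n ^ 2) = 4 ^ n).
  { rewrite <- Hqq. field. lra. }
  assert (p4 : 0 < (/ q) ^ 4) by (apply pow_lt, Rinv_0_lt_compat; auto).
  assert (l4 := Rmult_le_compat_l _ _ _ (Rlt_le _ _ p4) h4). rewrite e4 in l4. lra.
Qed.

(** Every pair of a good [m]-step index and a good [n]-step index concatenates to a distinct good
    index, at the cost 3 of [walkv_concat]. *)
Lemma count_concat m n s t : count m s * count n t <= count (m + n) (s + t - 3).
Proof.
  unfold count at 3. rewrite PeanoNat.Nat.pow_add_r, psum_mul_split.
  unfold count. rewrite Rmult_comm. unfold psum at 2. rewrite <- lsum_scal.
  apply lsum_le. intros a _. rewrite Rmult_comm. unfold psum. rewrite <- lsum_scal.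
  apply lsum_le. intros k Hk. apply in_seq in Hk.
  assert (h := walkv_concat m n a k ltac:(lia)).
  unfold indic. destruct (Rle_dec s (walkv m a)), (Rle_dec t (walkv n k)),
    (Rle_dec (s + t - 3) (walkv (m + n) (a * 4 ^ n + k))); lra.
Qed.

Lemma count_antitone n s t : s <= t -> count n t <= count n s.
Proof.
  intros H. apply lsum_le. intros k _. unfold indic.
  destruct (Rle_dec t (walkv n k)), (Rle_dec s (walkv n k)); lra.
Qed.

Lemma count_iter B n t c : 0 <= c -> c * 4 ^ n <= count n t ->
  c ^ B * 4 ^ (B * n) <= count (B * n) (INR B * (t - 3)).
Proof.
  intros Hc H. induction B as [|B IH].
  - unfold count, psum, walkv, walk, psum, indic. simpl.
    destruct (Rle_dec (0 * (t - 3)) 0); lra.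
  - rewrite S_INR. replace ((INR B + 1) * (t - 3)) with (t + INR B * (t - 3) - 3) by ring.
    change (S B * n)%nat with (n + B * n)%nat.
    eapply Rle_trans; [|apply count_concat]. rewrite pow_add. simpl.
    replace (c * c ^ B * (4 ^ n * 4 ^ (B * n))) with ((c * 4 ^ n) * (c ^ B * 4 ^ (B * n))) by ring.
    assert (h1 := pow4_pos n). assert (h2 := pow4_pos (B * n)). assert (h3 := pow_le c B Hc).
    apply Rmult_le_compat; auto; apply Rmult_le_pos; lra.
Qed.

Lemma exists_nat_ge (x : R) : exists n, x <= INR n.
Proof.
  destruct (INR_unbounded x) as [n Hn]. exists n. lra.
Qed.

(** Chain [B] blocks of length [n]. Once [sqrt n >= 60] each gains at least [sqrt n / 20] after the
    loss of 3, and [B * sqrt n / 20] is [sqrt B / 20] times [sqrt (B * n)]. The probability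
    [24 ^ -B] depends on [H] alone. *)
Lemma count_large_deviation H : 0 <= H -> exists p, 0 < p /\ forall n0, exists n, (n0 <= n)%nat /\
  p * 4 ^ n <= count n (H * sqrt (INR n)).
Proof.
  intros HH. destruct (exists_nat_ge ((20 * H) ^ 2 + 1)) as [B HB].
  exists ((/ 24) ^ B). split; [apply pow_lt; lra|]. intros n0.
  set (n := (n0 + 3600)%nat). exists (B * n)%nat.
  assert (HB1 : 1 <= INR B) by (assert (h := pow2_ge_0 (20 * H)); lra).
  assert (HB1' : (1 <= B)%nat) by (apply INR_le; simpl; lra).
  split; [unfold n; nia|].
  eapply Rle_trans; [apply (count_iter B n (sqrt (INR n) / 10) (/ 24))|].
  - lra.
  - assert (h := count_one_sided n ltac:(unfold n; lia)). lra.
  - apply count_antitone. rewrite mult_INR, sqrt_mult by apply pos_INR.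
    assert (hq : 60 <= sqrt (INR n)).
    { replace 60 with (sqrt (60 ^ 2)) by (apply sqrt_pow2; lra). apply sqrt_le_1_alt.
      unfold n. rewrite plus_INR. assert (h := pos_INR n0).
      replace (INR 3600) with 3600 by (rewrite INR_IZR_INZ; reflexivity). simpl. lra. }
    assert (hb : 20 * H <= sqrt (INR B)).
    { rewrite <- (sqrt_pow2 (20 * H)) by lra. apply sqrt_le_1_alt. lra. }
    assert (e : sqrt (INR B) * sqrt (INR B) = INR B) by (apply sqrt_sqrt; lra).
    apply Rle_trans with (INR B * (sqrt (INR n) / 20)); [|apply Rmult_le_compat_l; lra].
    rewrite <- e at 2.
    replace (sqrt (INR B) * sqrt (INR B) * (sqrt (INR n) / 20))
      with (sqrt (INR B) / 20 * (sqrt (INR B) * sqrt (INR n))) by field.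
    apply Rmult_le_compat_r; [|lra]. apply Rmult_le_pos; apply sqrt_pos.
Qed.

(** The new run is so long, [n >= (m + 3) ^ 2], that a past of at worst [-m] and the concatenation
    loss 3 are paid by one [sqrt n]. The other [2 * M] covers [sqrt (m + n) <= 2 * sqrt n], so the
    success rate is the same from every tile. *)
Lemma walkv_trial M : 0 <= M -> exists p, 0 < p <= 1 /\ forall m, exists n, forall a,
  p * 4 ^ n <= psum (fun k => indic (M * sqrt (INR (m + n))) (walkv (m + n) (a * 4 ^ n + k))) (4 ^ n).
Proof.
  intros HM. destruct (count_large_deviation (2 * M + 1) ltac:(lra)) as (p & Hp & H).
  exists p. split.
  - split; auto. destruct (H 0%nat) as (n & _ & Hn).
    assert (h : count n ((2 * M + 1) * sqrt (INR n)) <= 4 ^ n).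
    { apply Rle_trans with (lsum (fun _ => 1) (seq 0 (4 ^ n))).
      - apply lsum_le. intros; apply indic_bounds.
      - rewrite lsum_const, length_seq, INR_pow4. lra. }
    assert (h4 := pow4_pos n). apply (Rmult_le_reg_r (4 ^ n)); lra.
  - intros m. destruct (H ((m + 3) * (m + 3))%nat) as (n & Hn & Hc). exists n. intros a.
    eapply Rle_trans; [exact Hc|]. apply lsum_le. intros k Hk. apply in_seq in Hk.
    assert (h := walkv_concat m n a k ltac:(lia)). assert (hm := walkv_ge m a).
    assert (hq : INR m + 3 <= sqrt (INR n)).
    { replace (INR m + 3) with (sqrt ((INR m + 3) * (INR m + 3))) by (apply sqrt_square; assert (h0 := pos_INR m); lra).
      apply sqrt_le_1_alt. apply le_INR in Hn. rewrite mult_INR, plus_INR in Hn. simpl in Hn. lra. }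
    assert (hs : sqrt (INR (m + n)) <= 2 * sqrt (INR n)).
    { replace 2 with (sqrt 4) by (replace 4 with (2 * 2) by ring; apply sqrt_square; lra).
      rewrite <- sqrt_mult by (try lra; apply pos_INR). apply sqrt_le_1_alt.
      rewrite plus_INR. assert (INR m <= INR n) by (apply le_INR; nia). assert (h0 := pos_INR n). lra. }
    unfold indic. destruct (Rle_dec ((2 * M + 1) * sqrt (INR n)) (walkv n k)),
      (Rle_dec (M * sqrt (INR (m + n))) (walkv (m + n) (a * 4 ^ n + k))); try lra.
    exfalso. assert (M * sqrt (INR (m + n)) <= M * (2 * sqrt (INR n))) by now apply Rmult_le_compat_l. lra.
Qed.

(** * Covering by tiles on which the walk is large *)

(* The pair [(m, a)] encodes the 4-adic interval [[a / 4^m, (a + 1) / 4^m]]. *)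
Definition tile : Type := (nat * nat)%type.

Definition lft (t : tile) : R := INR (snd t) / 4 ^ fst t.

Definition rgt (t : tile) : R := (INR (snd t) + 1) / 4 ^ fst t.

Definition span (psi : R -> R) (t : tile) : R := psi (rgt t) - psi (lft t).

Definition len (t : tile) : R := / 4 ^ fst t.

Definition inside (t root : tile) : Prop := lft root <= lft t /\ rgt t <= rgt root.

Lemma rgt_lft t : rgt t = lft t + len t.
Proof. unfold rgt, lft, len, Rdiv. ring. Qed.

Lemma len_pos t : 0 < len t.
Proof. apply Rinv_0_lt_compat, pow4_pos. Qed.

Lemma inside_trans s t u : inside s t -> inside t u -> inside s u.
Proof. unfold inside. lra. Qed.

Definition children (n a : nat) : list nat := map (fun k => (a * 4 ^ n + k)%nat) (seq 0 (4 ^ n)).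

Lemma psum_telescope (g : nat -> R) n : psum (fun k => g (S k) - g k) n = g n - g 0%nat.
Proof.
  induction n as [|n IH]; [unfold psum; simpl; ring|]. rewrite psum_S, IH. ring.
Qed.

Lemma lft_child m n a k : lft (m + n, a * 4 ^ n + k)%nat = lft (m, a) + INR k * / 4 ^ (m + n).
Proof.
  unfold lft; simpl. rewrite plus_INR, mult_INR, INR_pow4, pow_add.
  assert (h1 := pow4_pos m). assert (h2 := pow4_pos n). field. lra.
Qed.

Lemma span_children psi m n a :
  lsum (fun b => span psi ((m + n)%nat, b)) (children n a) = span psi (m, a).
Proof.
  unfold children. rewrite lsum_map.
  transitivity (psum (fun k => psi (lft (m, a) + INR (S k) * / 4 ^ (m + n))
                     - psi (lft (m, a) + INR k * / 4 ^ (m + n))) (4 ^ n)).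
  - apply psum_ext. intros k. unfold span. rewrite rgt_lft, lft_child. unfold len; simpl fst.
    rewrite S_INR. do 2 f_equal. ring.
  - rewrite (psum_telescope (fun k => psi (lft (m, a) + INR k * / 4 ^ (m + n)))).
    unfold span. rewrite rgt_lft. unfold len; simpl fst. rewrite INR_pow4, pow_add.
    assert (h1 := pow4_pos m). assert (h2 := pow4_pos n).
    f_equal; f_equal; simpl INR; field; lra.
Qed.

Lemma inside_children m n a b : In b (children n a) -> inside ((m + n)%nat, b) (m, a).
Proof.
  intros H. apply in_map_iff in H. destruct H as (k & <- & Hk). apply in_seq in Hk.
  unfold inside. rewrite !rgt_lft, lft_child. unfold len; simpl fst.
  assert (h1 := pow4_pos m). assert (h2 := pow4_pos n).
  assert (h3 : 0 < / 4 ^ (m + n)) by apply Rinv_0_lt_compat, pow4_pos.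
  assert (h4 : 0 <= INR k) by apply pos_INR.
  assert (h5 : INR k + 1 <= 4 ^ n).
  { rewrite <- S_INR, <- INR_pow4. apply le_INR. lia. }
  split; [nra|].
  replace (/ 4 ^ m) with (4 ^ n * / 4 ^ (m + n)) by (rewrite pow_add; field; lra). nra.
Qed.

Lemma lsum_filter {A} (f : A -> R) b l : lsum f (filter b l) = lsum (fun x => if b x then f x else 0) l.
Proof. induction l as [|x l IH]; simpl; [reflexivity|]. destruct (b x); simpl; rewrite IH; ring. Qed.

Definition goodb (M : R) (m b : nat) : bool :=
  if Rle_dec (M * sqrt (INR m)) (walkv m b) then true else false.

Lemma cover_step M p m n (L : list nat) :
  (forall a, p * 4 ^ n <= psum (fun k => indic (M * sqrt (INR (m + n))) (walkv (m + n) (a * 4 ^ n + k))) (4 ^ n)) ->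
  let K := flat_map (children n) L in
  INR (length (filter (fun b => negb (goodb M (m + n) b)) K)) <= (1 - p) * 4 ^ n * INR (length L).
Proof.
  intros H K. rewrite <- (Rmult_1_l (INR (length (filter _ _)))), <- lsum_const, lsum_filter.
  unfold K. rewrite lsum_flat_map, <- lsum_const. apply lsum_le. intros a _.
  unfold children. rewrite lsum_map.
  assert (e : lsum (fun k => 1 + (-1) * indic (M * sqrt (INR (m + n))) (walkv (m + n) (a * 4 ^ n + k))) (seq 0 (4 ^ n))
     <= (1 - p) * 4 ^ n).
  { rewrite lsum_plus, lsum_scal, lsum_const, length_seq, INR_pow4. specialize (H a). unfold psum in H. lra. }
  eapply Rle_trans; [|exact e]. apply lsum_le. intros k _. unfold goodb, indic.
  destruct (Rle_dec _ _); simpl; lra.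
Qed.

(** [T] collects the stopped tiles and [U] those still running. Additivity of [span psi] for every
    [psi] encodes that together they tile the root; it replaces any statement of disjointness. *)
Lemma cover M m0 root : 0 <= M -> exists T U : list tile,
  (forall t, In t T -> (m0 <= fst t)%nat /\ M * sqrt (INR (fst t)) <= walkv (fst t) (snd t)
     /\ inside t root) /\
  (forall psi, lsum (span psi) T + lsum (span psi) U = span psi root) /\
  lsum len U <= len root / 2.
Proof.
  intros HM. destruct (walkv_trial M HM) as (p & Hp & Htrial). destruct root as [g r].
  (* State after [j] trials: all running tiles have the common depth [m], and they fill at most the
     fraction [(1 - p) ^ j] of the root. *)
  assert (Q : forall j, exists (T : list tile) (m : nat) (L : list nat), (m0 <= m)%nat /\
    (forall t, In t T -> (m0 <= fst t)%nat /\ M * sqrt (INR (fst t)) <= walkv (fst t) (snd t)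
       /\ inside t (g, r)) /\
    (forall a, In a L -> inside (m, a) (g, r)) /\
    (forall psi, lsum (span psi) T + lsum (fun a => span psi (m, a)) L = span psi (g, r)) /\
    INR (length L) * 4 ^ g <= (1 - p) ^ j * 4 ^ m).
  { induction j as [|j IH].
    - exists [], (g + m0)%nat, (children m0 r). split; [lia|]. split; [|split; [|split]].
      + intros t [].
      + intros a. apply inside_children.
      + intros psi. rewrite span_children. simpl. ring.
      + unfold children. rewrite length_map, length_seq, INR_pow4, pow_add. simpl. lra.
    - destruct IH as (T & m & L & Hm & HT & HL & Hsum & Hlen).
      destruct (Htrial m) as (n & Hn).
      set (K := flat_map (children n) L).
      assert (HK : forall b, In b K -> inside ((m + n)%nat, b) (g, r)).
      { intros b Hb. apply in_flat_map in Hb. destruct Hb as (a & Ha & Hb).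
        apply (inside_trans _ (m, a)); [apply inside_children|apply HL]; assumption. }
      exists (T ++ map (pair (m + n)%nat) (filter (goodb M (m + n)) K)), (m + n)%nat,
        (filter (fun b => negb (goodb M (m + n) b)) K).
      split; [lia|]. split; [|split; [|split]].
      + intros t Ht. apply in_app_or in Ht. destruct Ht as [Ht|Ht]; [now apply HT|].
        apply in_map_iff in Ht. destruct Ht as (b & <- & Hb). apply filter_In in Hb.
        destruct Hb as [Hb Hg]. simpl. split; [lia|]. split; [|now apply HK].
        unfold goodb in Hg. destruct (Rle_dec (M * sqrt (INR (m + n))) (walkv (m + n) b)); [assumption|discriminate].
      + intros a Ha. apply filter_In in Ha. now apply HK.
      + intros psi. rewrite <- Hsum, lsum_app, lsum_map, !lsum_filter, Rplus_assoc, <- lsum_plus. f_equal.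
        transitivity (lsum (fun b => span psi ((m + n)%nat, b)) K).
        * apply lsum_ext. intros b _. destruct (goodb M (m + n) b); simpl; ring.
        * unfold K. rewrite lsum_flat_map. apply lsum_ext. intros a _. apply span_children.
      + assert (h := cover_step M p m n L Hn). cbv zeta in h. fold K in h.
        assert (h1 := pow4_pos g). assert (h2 := pow4_pos n).
        apply Rle_trans with ((1 - p) * 4 ^ n * (INR (length L) * 4 ^ g)).
        * rewrite <- (Rmult_assoc ((1 - p) * 4 ^ n)). apply Rmult_le_compat_r; lra.
        * rewrite pow_add. simpl.
          replace ((1 - p) * (1 - p) ^ j * (4 ^ m * 4 ^ n)) with ((1 - p) * 4 ^ n * ((1 - p) ^ j * 4 ^ m)) by ring.
          apply Rmult_le_compat_l; auto. apply Rmult_le_pos; lra. }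
  destruct (pow_lt_1_zero (1 - p) ltac:(rewrite Rabs_pos_eq; lra) (1/2) ltac:(lra)) as (j & Hj).
  specialize (Hj j (le_n j)). rewrite Rabs_pos_eq in Hj by (apply pow_le; lra).
  destruct (Q j) as (T & m & L & Hm & HT & _ & Hsum & Hlen).
  exists T, (map (pair m) L). split; [exact HT|]. split.
  - intros psi. rewrite lsum_map. apply Hsum.
  - rewrite lsum_map. unfold len; simpl fst. rewrite lsum_const.
    assert (h1 := pow4_pos g). assert (h2 := pow4_pos m).
    apply (Rmult_le_reg_r (4 ^ g * 4 ^ m)). apply Rmult_lt_0_compat; auto.
    replace (/ 4 ^ m * INR (length L) * (4 ^ g * 4 ^ m)) with (INR (length L) * 4 ^ g) by (field; lra).
    replace (/ 4 ^ g / 2 * (4 ^ g * 4 ^ m)) with (/ 2 * 4 ^ m) by (field; lra).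
    eapply Rle_trans; [exact Hlen|]. apply Rmult_le_compat_r; lra.
Qed.

(** * Thinning *)

Fixpoint pairs {A : Type} (e : A -> A -> R) (l : list A) : R :=
  match l with [] => 0 | x :: l => lsum (e x) l + pairs e l end.

(* Method of conditional expectations: the right-hand side is the mean of the left-hand one over a random sublist keeping each entry with probability [p]. *)
Lemma exists_sublist_above_mean {A} (e : A -> A -> R) p l : 0 < p <= 1 ->
  forall u : A -> R, exists S, incl S l /\
    (forall f : A -> R, (forall x, 0 <= f x) -> lsum f S <= lsum f l) /\
    p * lsum u l - p ^ 2 * pairs e l <= lsum u S - pairs e S.
Proof.
  intros Hp. induction l as [|x l IH]; intros u.
  - exists []. split; [apply incl_refl|]. simpl. split; [intros; lra|lra].
  (* If [x] is kept, each later [y] is charged [e x y]; [S1] answers this reduced weight and [S0]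
     the case where [x] is dropped. *)
  - destruct (IH (fun y => u y + (-1) * e x y)) as (S1 & I1 & W1 & H1).
    destruct (IH u) as (S0 & I0 & W0 & H0).
    rewrite !lsum_plus, !lsum_scal in H1.
    destruct (Rle_dec (p * lsum u (x :: l) - p ^ 2 * pairs e (x :: l)) (lsum u S0 - pairs e S0)) as [h|h].
    + exists S0. split; [now apply incl_tl|]. split; auto.
      intros f Hf. specialize (W0 f Hf). specialize (Hf x). simpl. lra.
    + exists (x :: S1). split; [|split].
      * apply incl_cons; [now left|now apply incl_tl].
      * intros f Hf. specialize (W1 f Hf). simpl. lra.
      (* The mean of the two options with weights [p] and [1 - p] is at least the target; as
         dropping [x] falls short, keeping it succeeds. *)
      * apply Rnot_le_lt in h. simpl in *.
        set (G := p * (u x + lsum u l) - p * (p * 1) * (lsum (e x) l + pairs e l)) in *.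
        set (X0 := lsum u S0 - pairs e S0) in *.
        assert (hp := Rmult_le_compat_l p _ _ ltac:(lra) H1).
        assert (hq := Rmult_le_compat_l (1 - p) _ _ ltac:(lra) H0).
        assert (hr : (1 - p) * X0 <= (1 - p) * G) by (apply Rmult_le_compat_l; lra).
        apply (Rmult_le_reg_l p); [lra|]. unfold G in *. lra.
Qed.

Lemma lsum_lsum_pairs {A} (h : A -> A -> R) l :
  lsum (fun x => lsum (fun y => h x y) l) l
  = pairs (fun x y => h x y + h y x) l + lsum (fun x => h x x) l.
Proof.
  induction l as [|x l IH]; simpl; [ring|].
  rewrite !lsum_plus, IH. change (lsum (fun y => h x y) l) with (lsum (h x) l). ring.
Qed.

Lemma pairs_scal {A} c (e : A -> A -> R) l : pairs (fun x y => c * e x y) l = c * pairs e l.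
Proof. induction l as [|x l IH]; simpl; [ring|]. rewrite lsum_scal, IH. ring. Qed.

Lemma lsum_In_le {A} (f : A -> R) l x : (forall y, 0 <= f y) -> In x l -> f x <= lsum f l.
Proof.
  intros Hf. induction l as [|y l IH]; simpl; intros H; [tauto|].
  destruct H as [->|H].
  - assert (h := lsum_nonneg f l (fun y _ => Hf y)). lra.
  - specialize (IH H). specialize (Hf y). lra.
Qed.

Lemma lsum_swap {A B} (h : A -> B -> R) l1 l2 :
  lsum (fun x => lsum (fun y => h x y) l2) l1 = lsum (fun y => lsum (fun x => h x y) l1) l2.
Proof.
  induction l1 as [|x l1 IH]; simpl.
  - now rewrite lsum_const, Rmult_0_l.
  - now rewrite lsum_plus, IH.
Qed.

(** The column bounds make the total weighted row sum at most [c] times the weight. Sampling at rate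
    [p = 1 / (16 * c)] scales weight by [p] but interactions by [p ^ 2], so after an eightfold
    penalty at least half of [p] times the weight remains. Entries with too large a row sum are then
    deleted, as in Markov's inequality. *)
Lemma thinning {A} (wt : A -> R) (q : A -> A -> R) (l : list A) (c : R) :
  1 <= c -> (forall x, 0 <= wt x) -> (forall x y, 0 <= q y x) ->
  (forall x, In x l -> q x x = 1) ->
  (forall y, In y l -> lsum (fun x => wt x * q y x) l <= c * wt y) ->
  exists S, incl S l /\ (forall x, In x S -> lsum (fun y => q y x) S <= 9 / 8) /\
    lsum wt l / (32 * c) <= lsum wt S <= lsum wt l.
Proof.
  intros Hc Hwt Hq Hd Hcol.
  set (h := fun x y => wt x * q y x).
  set (p := / (16 * c)).
  assert (Hp : 0 < p <= 1).
  { unfold p. split. apply Rinv_0_lt_compat; lra. rewrite <- Rinv_1. apply Rinv_le_contravar; lra. }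
  assert (Hdiag : forall S, incl S l -> lsum (fun x => h x x) S = lsum wt S).
  { intros S HS. apply lsum_ext. intros x Hx. unfold h. rewrite Hd by auto. ring. }
  destruct (exists_sublist_above_mean (fun x y => 8 * (h x y + h y x)) p l ltac:(lra) wt) as (S & HS & HW & HF).
  rewrite !pairs_scal in HF.
  assert (El := lsum_lsum_pairs h l). assert (ES := lsum_lsum_pairs h S).
  rewrite Hdiag in El by apply incl_refl. rewrite Hdiag in ES by auto.
  assert (Wl : 0 <= lsum wt l) by (apply lsum_nonneg; auto).
  assert (Bl : lsum (fun x => lsum (fun y => h x y) l) l <= c * lsum wt l).
  { rewrite lsum_swap, <- lsum_scal. apply lsum_le. intros y Hy. now apply Hcol. }
  exists (filter (fun x => if Rle_dec (lsum (fun y => q y x) S) (9 / 8) then true else false) S).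
  split; [|split].
  - intros x Hx. apply filter_In in Hx. now apply HS.
  - intros x Hx. apply filter_In in Hx. destruct Hx as [_ Hx].
    destruct (Rle_dec (lsum (fun y => q y x) S) (9 / 8)) as [hx|]; [|discriminate].
    eapply Rle_trans; [|exact hx]. rewrite lsum_filter. apply lsum_le. intros y _.
    destruct (Rle_dec _ _); [lra|apply Hq].
  - split; cycle 1.
    { apply Rle_trans with (lsum wt S); [|now apply HW].
      rewrite lsum_filter. apply lsum_le. intros x _. specialize (Hwt x). destruct (Rle_dec _ _); lra. }
    apply Rle_trans with (lsum wt S - 8 * (pairs (fun x y => h x y + h y x) S)).
    + eapply Rle_trans; [|exact HF].
      apply Rle_trans with (p * lsum wt l - p ^ 2 * (8 * (c * lsum wt l))).
      * right. unfold p. field. lra.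
      * apply Rplus_le_compat_l, Ropp_le_contravar, Rmult_le_compat_l; [apply pow2_ge_0|lra].
    (* Entrywise, [9 - 8 * row] is at most 1 when the row sum is at least 1, and negative once it
       exceeds 9/8: the penalty already pays for the deletions. *)
    + replace (lsum wt S - 8 * pairs (fun x y => h x y + h y x) S)
        with (lsum (fun x => 9 * wt x + (-8) * lsum (fun y => h x y) S) S)
        by (rewrite lsum_plus, !lsum_scal; lra).
      rewrite lsum_filter. apply lsum_le. intros x Hx. unfold h. rewrite lsum_scal.
      assert (h1 := lsum_In_le (fun y => q y x) S x (Hq x) Hx). cbv beta in h1. rewrite Hd in h1 by auto.
      assert (h2 := Hwt x). destruct (Rle_dec (lsum (fun y => q y x) S) (9 / 8)); nra.
Qed.

(** * Points of the disc attached to tiles *)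

(** The height above the circle is the tile length. The left endpoint is used because there all
    frequencies [4 ^ k] with [k >= fst t] have angle 0 modulo [2 * PI]. *)
Definition pt (t : tile) : C :=
  ((1 - len t) * cos (2 * PI * lft t), (1 - len t) * sin (2 * PI * lft t)).

Lemma len_le m t : (m <= fst t)%nat -> len t <= / 4 ^ m.
Proof.
  intros H. apply Rinv_le_contravar; [apply pow4_pos|]. apply Rle_pow; [lra|auto].
Qed.

Lemma Cmod_pt t : Cmod (pt t) = 1 - len t.
Proof.
  assert (h := len_le 0 t ltac:(lia)). simpl in h. rewrite Rinv_1 in h.
  unfold Cmod, pt; simpl fst; simpl snd.
  replace (((1 - len t) * cos (2 * PI * lft t)) ^ 2 + ((1 - len t) * sin (2 * PI * lft t)) ^ 2)
    with ((1 - len t) ^ 2).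
  - apply sqrt_pow2. lra.
  - assert (e := cos2_sin2 (2 * PI * lft t)).
    replace ((1 - len t) ^ 2) with ((1 - len t) ^ 2 * 1) by ring. rewrite <- e. ring.
Qed.

Lemma Cmod_pt_lt_1 t : Cmod (pt t) < 1.
Proof. rewrite Cmod_pt. assert (h := len_pos t). lra. Qed.

Lemma sin_ge_half x : 0 <= x <= 1 -> x / 2 <= sin x.
Proof.
  intros [H0 H1]. destruct (sin_bound x 0 H0) as [h _].
  - assert (h := PI2_1). lra.
  - unfold sin_approx, sin_term in h. simpl in h. nra.
Qed.

Lemma Rabs_sin_ge x : Rabs x <= 1 -> Rabs x / 2 <= Rabs (sin x).
Proof.
  intros H. destruct (Rle_dec 0 x) as [h|h].
  - rewrite Rabs_pos_eq in * by auto. eapply Rle_trans; [now apply sin_ge_half|]. apply Rle_abs.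
  - rewrite <- (Rabs_Ropp x), <- (Rabs_Ropp (sin x)), <- sin_neg in *.
    rewrite (Rabs_pos_eq (-x)) in * by lra.
    eapply Rle_trans; [apply sin_ge_half; lra|]. apply Rle_abs.
Qed.

(** The imaginary part is a product of radii, at least 9/16, with the sine of [2 * PI] times the
    gap. A gap of at most 1/8 keeps that angle below 1, where the sine is at least half of it. *)
Lemma dst_pt_ge_lft s t : (1 <= fst s)%nat -> (1 <= fst t)%nat -> Rabs (lft t - lft s) <= 1 / 8 ->
  Rabs (lft t - lft s) <= dst (pt s) (pt t).
Proof.
  intros Hs Ht H. assert (hs := len_le 1 s Hs). assert (ht := len_le 1 t Ht).
  rewrite pow_1 in hs, ht. assert (ps := len_pos s). assert (ptt := len_pos t).
  unfold dst. eapply Rle_trans; [|apply im_le_Cmod].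
  replace (Im (1 - Cconj (pt s) * pt t)) with
    (- ((1 - len s) * (1 - len t) * sin (2 * PI * lft t - 2 * PI * lft s)))
    by (rewrite sin_minus; unfold pt; simpl; ring).
  rewrite Rabs_Ropp, !Rabs_mult, !(Rabs_pos_eq (1 - len _)) by lra.
  replace (2 * PI * lft t - 2 * PI * lft s) with (2 * PI * (lft t - lft s)) by ring.
  assert (P := PI2_3_2). assert (P4 := PI_4).
  assert (E : Rabs (2 * PI * (lft t - lft s)) = 2 * PI * Rabs (lft t - lft s))
    by (rewrite Rabs_mult, (Rabs_pos_eq (2 * PI)); lra).
  assert (d0 := Rabs_pos (lft t - lft s)).
  assert (h := Rabs_sin_ge (2 * PI * (lft t - lft s))). rewrite E in h.
  assert (h1 := h ltac:(nra)).
  assert (h2 : 9 / 16 <= (1 - len s) * (1 - len t)) by nra.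
  assert (h3 : 3 / 2 * (2 * Rabs (lft t - lft s)) <= 2 * PI * Rabs (lft t - lft s) / 2 * 2) by nra.
  assert (h4 := Rabs_pos (sin (2 * PI * (lft t - lft s)))). nra.
Qed.

Lemma dst_pt_ge_len s t : len s <= dst (pt s) (pt t) /\ len t <= dst (pt s) (pt t).
Proof.
  assert (h1 := dst_ge (pt s) (pt t) (Cmod_pt_lt_1 s) (Cmod_pt_lt_1 t)).
  assert (h2 := dst_ge (pt t) (pt s) (Cmod_pt_lt_1 t) (Cmod_pt_lt_1 s)).
  rewrite dst_sym in h2. rewrite Cmod_pt in h1, h2. lra.
Qed.

Lemma kerm_pt_le s t d : 0 < d -> d <= dst (pt s) (pt t) -> kerm (pt s) (pt t) <= 4 * (len s / d) ^ 2.
Proof.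
  intros Hd H. unfold kerm. rewrite Cmod_pt.
  assert (p := len_pos s). assert (h := len_le 0 s ltac:(lia)). simpl in h. rewrite Rinv_1 in h.
  replace (4 * (len s / d) ^ 2) with ((2 * len s / d) ^ 2) by (field; lra).
  apply pow_incr. assert (hi : 0 < / dst (pt s) (pt t)) by (apply Rinv_0_lt_compat; lra).
  assert (hj : / dst (pt s) (pt t) <= / d) by (apply Rinv_le_contravar; lra).
  unfold Rdiv. split.
  - apply Rmult_le_pos; nra.
  - apply Rmult_le_compat; nra.
Qed.

(* Algebraic stand-in for the arctangent, the primitive of the Poisson-type weight of [kerm] at scale [d] around [c]. *)
Definition sigmoid (c d u : R) : R := (u - c) / (d + Rabs (u - c)).

Lemma sigmoid_bounds c d u : 0 < d -> -1 <= sigmoid c d u <= 1.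
Proof.
  intros Hd. unfold sigmoid. assert (h := Rabs_pos (u - c)).
  assert (h1 := Rle_abs (u - c)). assert (h2 := Rle_abs (- (u - c))). rewrite Rabs_Ropp in h2.
  split.
  - apply (Rmult_le_reg_r (d + Rabs (u - c))); [lra|].
    unfold Rdiv. rewrite Rmult_assoc, Rinv_l by lra. lra.
  - apply (Rmult_le_reg_r (d + Rabs (u - c))); [lra|].
    unfold Rdiv. rewrite Rmult_assoc, Rinv_l by lra. lra.
Qed.

Lemma sigmoid_increment c d u l : 0 < d -> 0 <= l ->
  l * d / ((d + Rabs (u - c)) * (d + Rabs (u - c) + l)) <= sigmoid c d (u + l) - sigmoid c d u.
Proof.
  intros Hd Hl. unfold sigmoid. set (s := u - c). replace (u + l - c) with (s + l) by (unfold s; ring).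
  assert (hs := Rabs_pos s). assert (ht := Rabs_pos (s + l)).
  assert (htri : Rabs (s + l) <= Rabs s + l).
  { eapply Rle_trans; [apply Rabs_triang|]. rewrite (Rabs_pos_eq l); lra. }
  replace ((s + l) / (d + Rabs (s + l)) - s / (d + Rabs s)) with
    ((l * d + ((s + l) * Rabs s - s * Rabs (s + l))) / ((d + Rabs s) * (d + Rabs (s + l)))) by (field; lra).
  (* This vanishes if [s] and [s + l] have the same sign, and is positive if they straddle 0. *)
  assert (hn : 0 <= (s + l) * Rabs s - s * Rabs (s + l)).
  { unfold Rabs. destruct (Rcase_abs s), (Rcase_abs (s + l)); nra. }
  assert (hld : 0 <= l * d) by (apply Rmult_le_pos; lra).
  unfold Rdiv. apply Rmult_le_compat; [lra| | lra|].
  - apply Rlt_le, Rinv_0_lt_compat, Rmult_lt_0_compat; lra.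
  - apply Rinv_le_contravar. apply Rmult_lt_0_compat; lra. apply Rmult_le_compat_l; lra.
Qed.

(** As [dst] dominates both lengths and the gap, the sigmoid denominators are at most twice and
    three times [dst]; with the factor 4 of [kerm_pt_le] this makes 24. Summed over disjoint tiles,
    the right side is controlled by the total variation 2 of the sigmoid. *)
Lemma kerm_pt_le_span s t : (1 <= fst s)%nat -> (1 <= fst t)%nat -> Rabs (lft t - lft s) <= 1 / 8 ->
  len t * kerm (pt s) (pt t) <= 24 * len s * span (sigmoid (lft s) (len s)) t.
Proof.
  intros Hs Ht H. assert (h1 := dst_pt_ge_lft s t Hs Ht H). destruct (dst_pt_ge_len s t) as [h2 h3].
  assert (ps := len_pos s). assert (ptt := len_pos t).
  set (d := dst (pt s) (pt t)) in *. assert (hd : 0 < d) by lra.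
  assert (hk := kerm_pt_le s t d hd (Rle_refl _)).
  assert (hi := sigmoid_increment (lft s) (len s) (lft t) (len t) ps (Rlt_le _ _ ptt)).
  unfold span. rewrite rgt_lft. assert (h0 := Rabs_pos (lft t - lft s)).
  assert (hj : len t * len s / (6 * d ^ 2) <=
    len t * len s / ((len s + Rabs (lft t - lft s)) * (len s + Rabs (lft t - lft s) + len t))).
  { unfold Rdiv. apply Rmult_le_compat_l; [apply Rmult_le_pos; lra|]. apply Rinv_le_contravar.
    - apply Rmult_lt_0_compat; lra.
    - replace (6 * d ^ 2) with ((2 * d) * (3 * d)) by ring. apply Rmult_le_compat; lra. }
  apply Rle_trans with (len t * (4 * (len s / d) ^ 2)); [apply Rmult_le_compat_l; lra|].
  replace (len t * (4 * (len s / d) ^ 2)) with (24 * len s * (len t * len s / (6 * d ^ 2))) by (field; lra).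
  apply Rmult_le_compat_l; lra.
Qed.

(** * Stages of points and their separation *)

Lemma lft_inside_bounds t g : inside t (g, 1%nat) -> / 4 ^ g <= lft t <= 2 * / 4 ^ g.
Proof.
  intros [h1 h2]. rewrite rgt_lft in h2. assert (p := len_pos t).
  unfold lft at 1 in h1. unfold rgt in h2. simpl in h1, h2. unfold Rdiv in *. lra.
Qed.

(** Index 1 in the root keeps the stages apart. Level [k + 1] leaves a margin over [k] for the error
    of the walk against [lac], and depth [2 * k + 6] makes kernels between stages negligible. *)
Lemma stage_exists (k : nat) : exists L : list tile,
  (forall t, In t L -> (2 * k + 6 <= fst t)%nat
     /\ (INR k + 1) * sqrt (INR (fst t)) <= walkv (fst t) (snd t)
     /\ inside t ((k + 2)%nat, 1%nat)) /\
  (forall x, In x L -> lsum (fun y => kerm (pt y) (pt x)) L <= 9 / 8) /\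
  / 4 ^ (k + 2) / 3072 <= lsum len L <= / 4 ^ (k + 2).
Proof.
  set (root := ((k + 2)%nat, 1%nat)).
  destruct (cover (INR k + 1) (2 * k + 6) root) as (T & U & HT & Hsum & HU).
  { assert (h := pos_INR k). lra. }
  assert (Hlen : lsum len T + lsum len U = / 4 ^ (k + 2)).
  { assert (h : forall l, lsum (span (fun u => u)) l = lsum len l).
    { intros l. apply lsum_ext. intros t _. unfold span. rewrite rgt_lft. ring. }
    rewrite <- !h, Hsum. unfold span. rewrite rgt_lft. unfold len. simpl fst. ring. }
  change (len root) with (/ 4 ^ (k + 2)) in HU.
  assert (HU0 : 0 <= lsum len U) by (apply lsum_nonneg; intros; apply Rlt_le, len_pos).
  (* The constant 48 is 24 times the variation 2 of the sigmoid. Covering half the root and thinning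
     by [32 * 48] gives 3072. *)
  destruct (thinning len (fun y x => kerm (pt y) (pt x)) T 48) as (S & HS & Hrow & Hw).
  - lra.
  - intros; apply Rlt_le, len_pos.
  - intros; apply kerm_nonneg.
  - intros t _. apply kerm_diag, Cmod_pt_lt_1.
  - intros y Hy. apply Rle_trans with (lsum (fun x => 24 * len y * span (sigmoid (lft y) (len y)) x) T).
    + apply lsum_le. intros x Hx. destruct (HT x Hx) as (mx & _ & ix). destruct (HT y Hy) as (my & _ & iy).
      apply lft_inside_bounds in ix, iy. apply kerm_pt_le_span; try lia.
      apply Rabs_le. assert (h : / 4 ^ (k + 2) <= / 4 ^ 2).
      { apply Rinv_le_contravar; [lra|]. apply Rle_pow; [lra|lia]. }
      simpl in h. lra.
    + rewrite lsum_scal. assert (py := len_pos y).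
      assert (h : lsum (span (sigmoid (lft y) (len y))) T <= 2).
      { assert (e := Hsum (sigmoid (lft y) (len y))).
        assert (hU : 0 <= lsum (span (sigmoid (lft y) (len y))) U).
        { apply lsum_nonneg. intros u _. unfold span. rewrite rgt_lft. assert (pu := len_pos u).
          eapply Rle_trans; [|apply sigmoid_increment; lra].
          assert (a := Rabs_pos (lft u - lft y)).
          apply Rdiv_le_0_compat; [apply Rmult_le_pos; lra|apply Rmult_lt_0_compat; lra]. }
        assert (b1 := sigmoid_bounds (lft y) (len y) (rgt root) py).
        assert (b2 := sigmoid_bounds (lft y) (len y) (lft root) py). unfold span at 3 in e. lra. }
      change (24 * len y * lsum (span (sigmoid (lft y) (len y))) T <= 48 * len y). nra.
  - exists S. split; [|split].
    + intros t Ht. now apply HT, HS.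
    + exact Hrow.
    + lra.
Qed.

Lemma lft_separated j k s t : (j < k)%nat ->
  inside s ((j + 2)%nat, 1%nat) -> inside t ((k + 2)%nat, 1%nat) ->
  / 4 ^ (j + 2) / 2 <= lft s - lft t <= 1 / 8.
Proof.
  intros Hjk Hs Ht. apply lft_inside_bounds in Hs, Ht.
  assert (h : / 4 ^ (k + 2) <= / 4 ^ (S (j + 2))).
  { apply Rinv_le_contravar; [apply pow4_pos|]. apply Rle_pow; [lra|lia]. }
  assert (h2 : / 4 ^ (j + 2) <= / 4 ^ 2).
  { apply Rinv_le_contravar; [apply pow_lt; lra|]. apply Rle_pow; [lra|lia]. }
  assert (p := pow4_pos (j + 2)). assert (pk := Rinv_0_lt_compat _ (pow4_pos (k + 2))).
  replace (/ 4 ^ S (j + 2)) with (/ 4 ^ (j + 2) / 4) in h by (simpl; field; lra).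
  simpl (4 ^ 2) in h2. lra.
Qed.

(** The gap is at least [4 ^ -(j + 2) / 2], so the kernel is at most
    [16 * 4 ^ (2 * j + 4) * len s ^ 2]; depth [2 * j + 6] cancels exactly one factor [len s]. *)
Lemma kerm_pt_cross j k s t : j <> k -> (2 * j + 6 <= fst s)%nat -> (1 <= fst t)%nat ->
  inside s ((j + 2)%nat, 1%nat) -> inside t ((k + 2)%nat, 1%nat) ->
  kerm (pt s) (pt t) <= len s.
Proof.
  intros Hjk Hs Ht Is It.
  assert (pj := Rinv_0_lt_compat _ (pow4_pos (j + 2))).
  assert (H : / 4 ^ (j + 2) / 2 <= Rabs (lft t - lft s) <= 1 / 8).
  { destruct (Compare_dec.lt_dec j k) as [h|h].
    - destruct (lft_separated j k s t h Is It). rewrite Rabs_minus_sym, Rabs_pos_eq; lra.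
    - destruct (lft_separated k j t s ltac:(lia) It Is).
      assert (h2 : / 4 ^ (j + 2) <= / 4 ^ (k + 2)).
      { apply Rinv_le_contravar; [apply pow4_pos|]. apply Rle_pow; [lra|lia]. }
      rewrite Rabs_pos_eq; lra. }
  assert (hd := dst_pt_ge_lft s t ltac:(lia) Ht (proj2 H)).
  eapply Rle_trans; [apply (kerm_pt_le s t (/ 4 ^ (j + 2) / 2)); lra|].
  assert (hl := len_le _ s Hs). assert (ps := len_pos s).
  replace (2 * j + 6)%nat with ((j + 2) + (j + 2) + 2)%nat in hl by lia.
  rewrite (pow_add 4 (j + 2 + (j + 2)) 2), (pow_add 4 (j + 2) (j + 2)) in hl. set (P := 4 ^ (j + 2)) in *. assert (hP : 0 < P) by apply pow4_pos.
  replace (4 * (len s / (/ P / 2)) ^ 2) with (len s * (16 * P * P * len s)) by (field; lra).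
  rewrite <- (Rmult_1_r (len s)) at 3. apply Rmult_le_compat_l; [lra|].
  apply Rle_trans with (16 * P * P * / (P * P * 4 ^ 2)).
  - apply Rmult_le_compat_l; auto. repeat apply Rmult_le_pos; lra.
  - right. field. lra.
Qed.

(** * The lacunary Bloch function *)

Definition lac (z : C) : C := CSeries (fun k => Cpow z (4 ^ k)).

Definition lac' (z : C) : C := CSeries (fun k => RtoC (INR (4 ^ k)) * Cpow z (4 ^ k - 1))%C.

Lemma pow4_ge_1 k : (1 <= 4 ^ k)%nat.
Proof. induction k as [|k IH]; simpl; lia. Qed.

Lemma Cpow_pred (z : C) N : (INR N * z ^ (N - 1) * z = INR N * z ^ N)%C.
Proof.
  destruct N as [|N]; [simpl; ring|].
  replace (S N - 1)%nat with N by lia. rewrite (Cpow_S z N). ring.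
Qed.

(** The remainder of exponent [N + 1] is [w] times that of [N] plus [N * z ^ (N - 1) * (w - z) ^ 2],
    and [N ^ 2 + N <= (N + 1) ^ 2]. Multiplying by [R0 ^ 2] avoids the exponent [N - 2]. *)
Lemma Cpow_remainder (z w : C) (R0 : R) N : 0 < R0 -> Cmod z <= R0 -> Cmod w <= R0 ->
  Cmod (w ^ N - z ^ N - (w - z) * (INR N * z ^ (N - 1))) * R0 ^ 2
  <= INR N ^ 2 * R0 ^ N * Cmod (w - z) ^ 2.
Proof.
  intros HR Hz Hw. induction N as [|N IH].
  - replace (w ^ 0 - z ^ 0 - (w - z) * (INR 0 * z ^ (0 - 1)))%C with (RtoC 0) by (simpl; ring).
    rewrite Cmod_0. simpl. lra.
  - replace (w ^ S N - z ^ S N - (w - z) * (INR (S N) * z ^ (S N - 1)))%C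
      with (w * (w ^ N - z ^ N - (w - z) * (INR N * z ^ (N - 1))) + INR N * z ^ (N - 1) * (w - z) ^ 2)%C.
    + set (rem := (w ^ N - z ^ N - (w - z) * (INR N * z ^ (N - 1)))%C) in *.
      assert (h0 := Cmod_ge_0 rem). assert (hd := pow2_ge_0 (Cmod (w - z))). assert (hn := pos_INR N).
      assert (hR := pow_lt R0 N HR). assert (hR2 := pow_lt R0 2 HR).
      assert (h1 : Cmod (INR N * z ^ (N - 1)) * R0 <= INR N * R0 ^ N).
      { rewrite Cmod_mult, Cmod_R, Rabs_pos_eq, Cmod_pow by auto.
        destruct N as [|N]; [simpl; lra|]. replace (S N - 1)%nat with N by lia.
        rewrite Rmult_assoc. apply Rmult_le_compat_l; auto. simpl. rewrite Rmult_comm.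
        apply Rmult_le_compat_l; [lra|]. apply pow_incr. split; auto. apply Cmod_ge_0. }
      apply Rle_trans with ((R0 * Cmod rem + Cmod (INR N * z ^ (N - 1)) * Cmod (w - z) ^ 2) * R0 ^ 2).
      * apply Rmult_le_compat_r; [lra|]. eapply Rle_trans; [apply Cmod_triangle|].
        rewrite (Cmod_mult w rem), (Cmod_mult (INR N * z ^ (N - 1))%C), Cmod_pow.
        apply Rplus_le_compat_r, Rmult_le_compat_r; auto.
      * rewrite S_INR.
        apply Rle_trans with (R0 * (INR N ^ 2 * R0 ^ N * Cmod (w - z) ^ 2) + INR N * R0 ^ N * R0 * Cmod (w - z) ^ 2).
        -- apply Rle_trans with (R0 * (Cmod rem * R0 ^ 2) + (Cmod (INR N * z ^ (N - 1)) * R0) * R0 * Cmod (w - z) ^ 2).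
           right; ring. apply Rplus_le_compat. apply Rmult_le_compat_l; lra.
           apply Rmult_le_compat_r; auto. apply Rmult_le_compat_r; lra.
        -- replace ((INR N + 1) ^ 2 * R0 ^ S N * Cmod (w - z) ^ 2)
             with ((INR N + 1) ^ 2 * (R0 * R0 ^ N * Cmod (w - z) ^ 2)) by (simpl; ring).
           assert (h2 : 0 <= R0 * R0 ^ N * Cmod (w - z) ^ 2) by (apply Rmult_le_pos; auto; apply Rmult_le_pos; lra).
           replace (R0 * (INR N ^ 2 * R0 ^ N * Cmod (w - z) ^ 2) + INR N * R0 ^ N * R0 * Cmod (w - z) ^ 2)
             with ((INR N ^ 2 + INR N) * (R0 * R0 ^ N * Cmod (w - z) ^ 2)) by ring.
           apply Rmult_le_compat_r; auto. nra.
    + replace (S N - 1)%nat with N by lia. assert (h := Cpow_pred z N).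
      rewrite S_INR, RtoC_plus, !Cpow_S.
      transitivity (w * w ^ N - w * z ^ N - (w - z) * (INR N * z ^ (N - 1) * z))%C; [ring|].
      rewrite h. ring.
Qed.

Lemma ex_series_lacunary (R0 : R) : 0 < R0 < 1 -> ex_series (fun k => INR (4 ^ k) ^ 2 * R0 ^ (4 ^ k)).
Proof.
  intros HR.
  assert (P : forall k, 0 < INR (4 ^ k) ^ 2 * R0 ^ (4 ^ k)).
  { intros k. apply Rmult_lt_0_compat; apply pow_lt; [rewrite INR_pow4; apply pow4_pos|lra]. }
  apply (ex_series_ext (fun k => Rabs (INR (4 ^ k) ^ 2 * R0 ^ (4 ^ k)))).
  { intros k. apply Rabs_pos_eq, Rlt_le, P. }
  apply (ex_series_DAlembert _ 0); [lra| |].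
  - intros k. assert (h := P k). lra.
  - apply (is_lim_seq_ext (fun k => 16 * R0 ^ (3 * 4 ^ k))).
    + intros k. rewrite Rabs_pos_eq.
      * rewrite !INR_pow4. change (4 ^ S k)%nat with (4 * 4 ^ k)%nat.
        replace (4 * 4 ^ k)%nat with (4 ^ k + 3 * 4 ^ k)%nat by lia. rewrite pow_add.
        simpl (4 ^ S k). field. split; apply pow_nonzero; lra.
      * apply Rlt_le, Rdiv_lt_0_compat; apply P.
    + replace (Finite 0) with (Finite (16 * 0)) by (f_equal; ring).
      apply is_lim_seq_mult'; [apply is_lim_seq_const|].
      apply (is_lim_seq_subseq (fun n => R0 ^ n) 0 (fun k => (3 * 4 ^ k)%nat)).
      * apply eventually_subseq. intros k. simpl. assert (h := pow4_ge_1 k). lia.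
      * apply is_lim_seq_geom. rewrite Rabs_pos_eq; lra.
Qed.

Lemma lac_dominated R0 z k : 0 < R0 <= 1 -> Cmod z <= R0 ->
  Cmod (z ^ (4 ^ k)) <= INR (4 ^ k) ^ 2 * R0 ^ (4 ^ k) * / R0 ^ 2.
Proof.
  intros HR Hz. rewrite Cmod_pow.
  assert (h : Cmod z ^ (4 ^ k) <= R0 ^ (4 ^ k)) by (apply pow_incr; split; [apply Cmod_ge_0|lra]).
  assert (hp : 0 < R0 ^ (4 ^ k)) by (apply pow_lt; lra).
  assert (h1 : 1 <= INR (4 ^ k)) by (apply (le_INR 1), pow4_ge_1).
  assert (h2 : 1 <= / R0 ^ 2).
  { rewrite <- Rinv_1. apply Rinv_le_contravar. apply pow_lt; lra. nra. }
  assert (h3 : 1 <= INR (4 ^ k) ^ 2) by nra.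
  assert (h4 : R0 ^ (4 ^ k) <= INR (4 ^ k) ^ 2 * R0 ^ (4 ^ k)) by nra. nra.
Qed.

Lemma lac'_dominated R0 z k : 0 < R0 <= 1 -> Cmod z <= R0 ->
  Cmod (INR (4 ^ k) * z ^ (4 ^ k - 1)) <= INR (4 ^ k) ^ 2 * R0 ^ (4 ^ k) * / R0 ^ 2.
Proof.
  intros HR Hz. rewrite Cmod_mult, Cmod_R, Rabs_pos_eq, Cmod_pow by apply pos_INR.
  assert (hk := pow4_ge_1 k).
  assert (h : Cmod z ^ (4 ^ k - 1) <= R0 ^ (4 ^ k - 1)) by (apply pow_incr; split; [apply Cmod_ge_0|lra]).
  assert (hp : 0 < R0 ^ (4 ^ k - 1)) by (apply pow_lt; lra).
  assert (h1 : 1 <= INR (4 ^ k)) by (apply (le_INR 1); auto).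
  replace (R0 ^ (4 ^ k)) with (R0 * R0 ^ (4 ^ k - 1))
    by (change (R0 * R0 ^ (4 ^ k - 1)) with (R0 ^ S (4 ^ k - 1)); f_equal; lia).
  replace (INR (4 ^ k) ^ 2 * (R0 * R0 ^ (4 ^ k - 1)) * / R0 ^ 2)
    with (INR (4 ^ k) * (R0 ^ (4 ^ k - 1) * (INR (4 ^ k) * / R0))) by (field; lra).
  apply Rmult_le_compat_l; [lra|].
  assert (h2 : 1 <= / R0) by (rewrite <- Rinv_1; apply Rinv_le_contravar; lra).
  assert (h3 : 1 <= INR (4 ^ k) * / R0) by nra. nra.
Qed.

Lemma lac_majorant_ex_series R0 : 0 < R0 < 1 ->
  ex_series (fun k => INR (4 ^ k) ^ 2 * R0 ^ (4 ^ k) * / R0 ^ 2).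
Proof. intros HR. now apply ex_series_scal_r, ex_series_lacunary. Qed.

Lemma is_derive_lac z : Cmod z < 1 -> @is_derive C_AbsRing C_NormedModule lac z (lac' z).
Proof.
  intros Hz. set (R0 := (1 + Cmod z) / 2). assert (h0 := Cmod_ge_0 z).
  assert (HR : 0 < R0 < 1) by (unfold R0; lra).
  assert (Hb : forall w, Cmod (w - z) < (1 - Cmod z) / 2 -> Cmod w <= R0).
  { intros w Hw. assert (h := Cmod_minus_ge w z). unfold R0. lra. }
  assert (Hz0 : Cmod z <= R0) by (unfold R0; lra).
  assert (Hs := lac_majorant_ex_series R0 HR).
  apply (is_derive_CSeries (fun k w => Cpow w (4 ^ k)) _ z ((1 - Cmod z) / 2)
    (fun k => INR (4 ^ k) ^ 2 * R0 ^ (4 ^ k) * / R0 ^ 2)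
    (fun k => INR (4 ^ k) ^ 2 * R0 ^ (4 ^ k) * / R0 ^ 2)); auto.
  - lra.
  - intros k w Hw. apply lac_dominated; auto. lra.
  - intros k. apply lac'_dominated; auto. lra.
  - intros k w Hw. assert (h := Cpow_remainder z w R0 (4 ^ k) (proj1 HR) Hz0 (Hb w Hw)).
    assert (hp : 0 < R0 ^ 2) by (apply pow_lt; lra).
    apply (Rmult_le_reg_r (R0 ^ 2)); auto. eapply Rle_trans; [exact h|]. right. field. lra.
Qed.

(* [(1 - r) (r^(n+j-1) + ... + r^n) = r^n - r^(n+j)], with each power bounded below by the smallest. *)
Lemma geometric_block r n j : 0 <= r <= 1 -> (1 - r) * (INR j * r ^ (n + j - 1)) <= r ^ n - r ^ (n + j).
Proof.
  intros Hr. induction j as [|j IH].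
  - rewrite PeanoNat.Nat.add_0_r. simpl. lra.
  - replace (n + S j - 1)%nat with (n + j)%nat by lia. rewrite PeanoNat.Nat.add_succ_r. simpl (r ^ S _).
    assert (hp := pow_le r (n + j) (proj1 Hr)).
    destruct j as [|j]; [rewrite PeanoNat.Nat.add_0_r in *; simpl in *; lra|].
    assert (e : r ^ (n + S j) = r * r ^ (n + S j - 1))
      by (change (r * r ^ (n + S j - 1)) with (r ^ S (n + S j - 1)); f_equal; lia).
    assert (hq := pow_le r (n + S j - 1) (proj1 Hr)).
    assert (hj := pos_INR (S j)). rewrite (S_INR (S j)).
    assert (h1 : (1 - r) * (INR (S j) * r ^ (n + S j)) <= (1 - r) * (INR (S j) * r ^ (n + S j - 1))).
    { apply Rmult_le_compat_l; [lra|]. apply Rmult_le_compat_l; auto. rewrite e. nra. }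
    lra.
Qed.

(** The term of exponent [4 ^ (N + 1) - 1] is 4/3 of [3 * 4 ^ N] copies of the smallest power in its
    block, so [geometric_block] makes the bounds telescope. *)
Lemma lac'_weighted_sum r N : 0 <= r <= 1 ->
  (1 - r) * psum (fun k => INR (4 ^ k) * r ^ (4 ^ k - 1)) (S N) <= 1 + 4 / 3 * (r - r ^ (4 ^ N)).
Proof.
  intros Hr. induction N as [|N IH].
  - rewrite psum_S. unfold psum; simpl. lra.
  - rewrite psum_S. set (s := psum (fun k => INR (4 ^ k) * r ^ (4 ^ k - 1)) (S N)) in *.
    assert (h := geometric_block r (4 ^ N) (3 * 4 ^ N) Hr).
    replace (4 ^ N + 3 * 4 ^ N)%nat with (4 ^ S N)%nat in h by (simpl; lia).
    replace (INR (4 ^ S N)) with (4 / 3 * INR (3 * 4 ^ N)).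
    + rewrite Rmult_plus_distr_l. lra.
    + change (4 ^ S N)%nat with (4 * 4 ^ N)%nat. rewrite !mult_INR. simpl (INR 3). simpl (INR 4). field.
Qed.

Lemma Cminus_0_r (c : C) : (c - 0)%C = c.
Proof. ring. Qed.

Lemma bloch_lac : bloch lac.
Proof.
  exists lac'. split; [exact is_derive_lac|]. exists (14 / 3). intros z Hz. assert (h0 := Cmod_ge_0 z).
  set (R0 := (1 + Cmod z) / 2).
  assert (HR : 0 < R0 < 1) by (unfold R0; lra). assert (Hz0 : Cmod z <= R0) by (unfold R0; lra).
  assert (B : Cmod (lac' z) <= 7 / 3 / (1 - Cmod z)).
  { unfold lac'. rewrite <- (Cminus_0_r (CSeries _)).
    apply (CSeries_in_ball _ (fun k => INR (4 ^ k) ^ 2 * R0 ^ (4 ^ k) * / R0 ^ 2) _ _ 1).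
    - intros k. apply lac'_dominated; auto. lra.
    - now apply lac_majorant_ex_series.
    - intros [|N] HN; [lia|].
      rewrite Cminus_0_r. eapply Rle_trans; [apply Cmod_csum_le|].
      replace (psum _ (S N)) with (psum (fun k => INR (4 ^ k) * Cmod z ^ (4 ^ k - 1)) (S N)).
      + assert (h := lac'_weighted_sum (Cmod z) N ltac:(lra)).
        apply (Rmult_le_reg_l (1 - Cmod z)); [lra|].
        replace ((1 - Cmod z) * (7 / 3 / (1 - Cmod z))) with (7 / 3) by (field; lra).
        assert (hp := pow_le (Cmod z) (4 ^ N) h0). lra.
      + apply psum_ext. intros k. now rewrite Cmod_mult, Cmod_R, Rabs_pos_eq, Cmod_pow by apply pos_INR. }
  apply Rle_trans with (7 / 3 / (1 - Cmod z) * (1 - Cmod z ^ 2)).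
  - apply Rmult_le_compat_r; auto. nra.
  - replace (7 / 3 / (1 - Cmod z) * (1 - Cmod z ^ 2)) with (7 / 3 * (1 + Cmod z)) by (field; lra). lra.
Qed.

Lemma polar_pow r th N : Cpow (r * cos th, r * sin th) N = (r ^ N * cos (INR N * th), r ^ N * sin (INR N * th)).
Proof.
  induction N as [|N IH].
  - simpl. rewrite Rmult_0_l, cos_0, sin_0. apply injective_projections; simpl; ring.
  - rewrite Cpow_S, IH, S_INR. replace ((INR N + 1) * th) with (th + INR N * th) by ring.
    rewrite cos_plus, sin_plus. apply injective_projections; simpl; ring.
Qed.

Lemma one_minus_pow_le r N : 0 <= r <= 1 -> 1 - r ^ N <= INR N * (1 - r).
Proof.
  intros Hr. induction N as [|N IH]; [simpl; lra|].
  rewrite S_INR. simpl. assert (h : r ^ N <= 1) by (rewrite <- (pow1 N); apply pow_incr; lra).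
  assert (h1 := pow_le r N (proj1 Hr)). nra.
Qed.

Lemma psum_le_Series_tail f m : ex_series f -> (forall k, (m <= k)%nat -> 0 <= f k) -> psum f m <= Series f.
Proof.
  intros Hf H0. apply Series_correct, is_series_psum in Hf.
  apply is_lim_seq_incr_n with (N := m) in Hf.
  refine (is_lim_seq_le (fun _ => psum f m) _ _ _ _ (is_lim_seq_const _) Hf).
  intros n. rewrite PeanoNat.Nat.add_comm, psum_shift.
  assert (h : 0 <= psum (fun i => f (m + i)%nat) n) by (apply lsum_nonneg; intros i _; apply H0; lia).
  lra.
Qed.

(* At the scale of the tile the higher frequencies all contribute positive real terms. *)
Lemma walkv_le_Cmod_lac t : (1 <= fst t)%nat -> walkv (fst t) (snd t) - 1 <= Cmod (lac (pt t)).
Proof.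
  intros Ht. eapply Rle_trans; [|apply re_le_Cmod]. eapply Rle_trans; [|apply Rle_abs].
  assert (hl := len_le 1 t Ht). rewrite pow_1 in hl. assert (hp := len_pos t).
  set (r := 1 - len t). assert (Hr : 3 / 4 <= r < 1) by (unfold r; lra).
  set (m := fst t). set (a := snd t).
  assert (E : forall k, Re (Cpow (pt t) (4 ^ k)) = r ^ (4 ^ k) * cos (2 * PI * (4 ^ k * lft t))).
  { intros k. unfold pt. fold r. rewrite polar_pow, INR_pow4. simpl. f_equal. f_equal. ring. }
  change (Re (lac (pt t))) with (Series (fun k => Re (Cpow (pt t) (4 ^ k)))).
  apply Rle_trans with (psum (fun k => Re (Cpow (pt t) (4 ^ k))) m).
  - unfold walkv, walk. fold m a. change (INR a / 4 ^ m) with (lft t).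
    (* Replacing [r ^ (4 ^ k)] by 1 costs at most [4 ^ k * len t]; over [k < m] these losses sum to
       less than 1/3. *)
    assert (h : psum (fun k => cos (2 * PI * (4 ^ k * lft t)) + (- len t) * 4 ^ k) m
                <= psum (fun k => Re (Cpow (pt t) (4 ^ k))) m).
    { apply lsum_le. intros k _. rewrite E. assert (h1 := one_minus_pow_le r (4 ^ k) ltac:(lra)).
      rewrite INR_pow4 in h1. replace (1 - r) with (len t) in h1 by (unfold r; ring).
      assert (h2 : r ^ (4 ^ k) <= 1) by (rewrite <- (pow1 (4 ^ k)); apply pow_incr; lra).
      assert (h3 := COS_bound (2 * PI * (4 ^ k * lft t))). nra. }
    unfold psum in h at 1. rewrite lsum_plus, lsum_scal in h.
    change (psum (fun k => cos (2 * PI * (4 ^ k * lft t))) m + - len t * psum (fun k => 4 ^ k) m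
      <= psum (fun k => Re (Cpow (pt t) (4 ^ k))) m) in h.
    assert (g : forall n, psum (fun k => 4 ^ k) n = (4 ^ n - 1) / 3).
    { induction n as [|n IH]; [unfold psum; simpl; field|]. rewrite psum_S, IH. simpl. field. }
    rewrite g in h. assert (h4 := pow4_pos m).
    assert (e : len t * ((4 ^ m - 1) / 3) = / 3 - len t / 3) by (unfold len; fold m; field; lra). lra.
  - apply psum_le_Series_tail.
    + apply (ex_series_Re _ (fun k => INR (4 ^ k) ^ 2 * r ^ (4 ^ k) * / r ^ 2)).
      * intros k. apply lac_dominated; [lra|]. rewrite Cmod_pt. unfold r; lra.
      * apply lac_majorant_ex_series. lra.
    + intros k Hk. rewrite E. replace (4 ^ k * lft t) with (0 + INR (4 ^ (k - m) * a)).
      * rewrite cos_add_INR, Rmult_0_r, cos_0, Rmult_1_r. apply pow_le; lra.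
      * rewrite mult_INR, INR_pow4. unfold lft. fold m a. assert (h4 := pow4_pos m).
        replace (4 ^ k) with (4 ^ (k - m) * 4 ^ m) by (rewrite <- pow_add; f_equal; lia). field. lra.
Qed.

Lemma lac_0 : lac 0 = 0%C.
Proof.
  unfold lac. rewrite (CSeries_ext _ (fun _ => 0 * 0)%C).
  - rewrite (CSeries_scal 0 (fun _ => 0%C) (fun _ => 0)); [ring| |].
    + intros _; rewrite Cmod_0; lra.
    + apply (ex_series_psum_bounded _ 0). intros; lra. intros N. unfold psum; rewrite lsum_const; lra.
  - intros k. assert (h := pow4_ge_1 k). destruct (4 ^ k)%nat as [|N]; [lia|]. rewrite Cpow_S. ring.
Qed.

(** * Divergence along the enumerated stages *)

Definition summand (lambda : R) (z : C) : R :=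
  exp (lambda * Cmod (Cminus (lac z) (lac 0%C)) ^ 2 / (- ln (1 - Cmod z ^ 2))) * (1 - Cmod z ^ 2).

Lemma ln_4_le_2 : ln 4 <= 2.
Proof.
  replace 4 with (2 * 2) by ring. rewrite ln_mult by lra.
  assert (h := exp_ineq1 1 ltac:(lra)).
  assert (ln 2 < 1) by (rewrite <- (ln_exp 1); apply ln_increasing; lra). lra.
Qed.

(** With [m = fst t], the margin gives [(k + 1) * sqrt m - 1 >= k * sqrt m], while the logarithm is
    at most [m * ln 4 <= 2 * m]; the quotient is therefore at least [k ^ 2 / 2]. *)
Lemma summand_pt_ge lambda k t : 0 < lambda -> (1 <= fst t)%nat ->
  (INR k + 1) * sqrt (INR (fst t)) <= walkv (fst t) (snd t) ->
  exp (lambda * INR k ^ 2 / 2) * len t <= summand lambda (pt t).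
Proof.
  intros Hl Ht Hw. unfold summand. rewrite Cmod_pt, lac_0.
  replace (lac (pt t) - 0)%C with (lac (pt t)) by ring.
  assert (hb := walkv_le_Cmod_lac t Ht).
  assert (hl := len_le 1 t Ht). rewrite pow_1 in hl. assert (hp := len_pos t).
  assert (hm : 1 <= INR (fst t)) by (apply (le_INR 1); auto).
  assert (hq : 1 <= sqrt (INR (fst t))) by (rewrite <- sqrt_1; now apply sqrt_le_1_alt).
  assert (hk := pos_INR k).
  assert (hc : INR k * sqrt (INR (fst t)) <= Cmod (lac (pt t))) by lra.
  assert (hc2 : INR k ^ 2 * INR (fst t) <= Cmod (lac (pt t)) ^ 2).
  { replace (INR k ^ 2 * INR (fst t)) with ((INR k * sqrt (INR (fst t))) ^ 2).
    - apply pow_incr. split; auto. apply Rmult_le_pos; lra.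
    - rewrite Rpow_mult_distr. f_equal. simpl. rewrite Rmult_1_r. apply sqrt_sqrt. lra. }
  assert (hr : len t <= 1 - (1 - len t) ^ 2 < 1) by nra.
  assert (hln1 : ln (1 - (1 - len t) ^ 2) < 0) by (rewrite <- ln_1; apply ln_increasing; lra).
  assert (hln2 : - ln (1 - (1 - len t) ^ 2) <= 2 * INR (fst t)).
  { assert (h : ln (len t) <= ln (1 - (1 - len t) ^ 2)) by (apply ln_le; lra).
    unfold len in h at 1. rewrite ln_Rinv, ln_pow in h by (try apply pow4_pos; lra).
    assert (h2 := ln_4_le_2). nra. }
  set (D := - ln (1 - (1 - len t) ^ 2)) in *. assert (hD : 0 < D) by (unfold D; lra).
  apply Rmult_le_compat; try lra; [apply Rlt_le, exp_pos|].
  assert (hx : lambda * INR k ^ 2 / 2 <= lambda * Cmod (lac (pt t)) ^ 2 / D).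
  { apply (Rmult_le_reg_r D); auto. unfold Rdiv at 2. rewrite Rmult_assoc, Rinv_l, Rmult_1_r by lra.
    assert (h2 := pow2_ge_0 (INR k)).
    apply Rle_trans with (lambda * (INR k ^ 2 * INR (fst t))); [|apply Rmult_le_compat_l; lra].
    replace (lambda * INR k ^ 2 / 2 * D) with (lambda * (INR k ^ 2 * (D / 2))) by field.
    apply Rmult_le_compat_l; [lra|]. apply Rmult_le_compat_l; lra. }
  destruct hx as [hx|hx]; [left; now apply exp_increasing|right; now rewrite hx].
Qed.

Lemma summand_nonneg lambda z : Cmod z < 1 -> 0 <= summand lambda z.
Proof.
  intros Hz. apply Rmult_le_pos; [apply Rlt_le, exp_pos|]. assert (h := Cmod_ge_0 z). nra.
Qed.

Lemma psum_nth {A} (f : A -> R) l d : psum (fun n => f (nth n l d)) (length l) = lsum f l.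
Proof.
  induction l as [|x l IH]; [reflexivity|].
  unfold psum in *. simpl. rewrite <- seq_shift, lsum_map. f_equal. exact IH.
Qed.

Lemma exp_quadratic_unbounded lambda c Y : 0 < lambda -> 0 < c ->
  exists k, Y <= exp (lambda * INR k ^ 2 / 2) * (c * / 4 ^ k).
Proof.
  (* For [lambda * k >= 6] the exponent is at least [3 * k]; since [ln 4 <= 2], a factor
     [exp k >= k] survives division by [4 ^ k]. *)
  intros Hl Hc. destruct (exists_nat_ge (6 / lambda)) as [k1 H1]. destruct (exists_nat_ge (Y / c)) as [k2 H2].
  exists (k1 + k2)%nat. set (k := (k1 + k2)%nat).
  assert (h1 : 6 <= lambda * INR k).
  { unfold k. rewrite plus_INR. assert (h := pos_INR k2).
    apply (Rmult_le_compat_l lambda) in H1; [|lra].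
    replace (lambda * (6 / lambda)) with 6 in H1 by (field; lra). nra. }
  assert (h2 : Y <= c * INR k).
  { unfold k. rewrite plus_INR. assert (h := pos_INR k1).
    apply (Rmult_le_compat_l c) in H2; [|lra].
    replace (c * (Y / c)) with Y in H2 by (field; lra). nra. }
  assert (hk := pos_INR k).
  assert (h3 : exp (INR k) <= exp (lambda * INR k ^ 2 / 2) * / 4 ^ k).
  { rewrite <- (exp_ln (4 ^ k)) by apply pow4_pos. rewrite <- exp_Ropp, <- exp_plus, ln_pow by lra.
    assert (h := ln_4_le_2).
    assert (hx : INR k <= lambda * INR k ^ 2 / 2 + - (INR k * ln 4)) by nra.
    destruct hx as [hx|hx]; [left; now apply exp_increasing|right; now rewrite <- hx]. }
  assert (h4 : INR k <= exp (INR k)) by (assert (h := exp_ineq1_le (INR k)); lra).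
  replace (exp (lambda * INR k ^ 2 / 2) * (c * / 4 ^ k)) with (c * (exp (lambda * INR k ^ 2 / 2) * / 4 ^ k)) by ring.
  nra.
Qed.

Section Flattening.

Variable Lf : nat -> list tile.
Hypothesis Lf_tiles : forall k t, In t (Lf k) -> (2 * k + 6 <= fst t)%nat
     /\ (INR k + 1) * sqrt (INR (fst t)) <= walkv (fst t) (snd t)
     /\ inside t ((k + 2)%nat, 1%nat).
Hypothesis Lf_row : forall k x, In x (Lf k) -> lsum (fun y => kerm (pt y) (pt x)) (Lf k) <= 9 / 8.
Hypothesis Lf_len : forall k, / 4 ^ (k + 2) / 3072 <= lsum len (Lf k) <= / 4 ^ (k + 2).

Definition flat (K : nat) : list tile := flat_map Lf (seq 0 K).

(** Stages are nonempty, so the first [n + 1] of them contain an entry of index [n] and the default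
    is never read. *)
Definition tile_seq (n : nat) : tile := nth n (flat (S n)) (1%nat, 0%nat).

Lemma flat_S K : flat (S K) = flat K ++ Lf K.
Proof. unfold flat. rewrite seq_S, flat_map_app. simpl. now rewrite app_nil_r. Qed.

Lemma length_flat K : (K <= length (flat K))%nat.
Proof.
  induction K as [|K IH]; [simpl; lia|]. rewrite flat_S, length_app.
  assert (h := Lf_len K). assert (p := Rinv_0_lt_compat _ (pow4_pos (K + 2))).
  destruct (Lf K) as [|t l]; simpl in *; [lra|lia].
Qed.

Lemma flat_prefix K K' : (K <= K')%nat -> exists l, flat K' = flat K ++ l.
Proof.
  induction 1 as [|K' _ [l IH]]; [exists []; now rewrite app_nil_r|].
  exists (l ++ Lf K'). now rewrite flat_S, IH, app_assoc.
Qed.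

Lemma tile_seq_nth n K : (n < K)%nat -> tile_seq n = nth n (flat K) (1%nat, 0%nat).
Proof.
  intros H. destruct (flat_prefix (S n) K ltac:(lia)) as [l ->].
  unfold tile_seq. rewrite app_nth1; auto. assert (h := length_flat (S n)). lia.
Qed.

Lemma nth_flat_tile_seq n K : (n < length (flat K))%nat -> nth n (flat K) (1%nat, 0%nat) = tile_seq n.
Proof.
  intros H. rewrite (tile_seq_nth n (S n + K)) by lia.
  destruct (flat_prefix K (S n + K) ltac:(lia)) as [l ->]. now rewrite app_nth1.
Qed.

Lemma tile_seq_In n : exists k, In (tile_seq n) (Lf k).
Proof.
  assert (h : In (tile_seq n) (flat (S n))).
  { apply nth_In. assert (h := length_flat (S n)). lia. }
  apply in_flat_map in h. destruct h as (k & _ & h). now exists k.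
Qed.

Lemma psum_tile_seq_flat f K : psum (fun n => f (tile_seq n)) (length (flat K)) = lsum f (flat K).
Proof.
  rewrite <- (psum_nth f (flat K) (1%nat, 0%nat)). apply lsum_ext. intros n Hn. apply in_seq in Hn.
  now rewrite nth_flat_tile_seq by lia.
Qed.

Lemma row_sum_flat k x K : In x (Lf k) -> lsum (fun y => kerm (pt y) (pt x)) (flat K) <= 5 / 4.
Proof.
  intros Hx.
  (* The own stage gives 9/8. The others give at most the sum of [4 ^ -(j + 2)], which is 1/12 in
     the limit and fits into the remaining 1/8. *)
  assert (B : lsum (fun y => kerm (pt y) (pt x)) (flat K) <=
              (1 - / 4 ^ K) / 12 + (if Compare_dec.lt_dec k K then 9 / 8 else 0)).
  { induction K as [|K IH].
    - simpl. destruct (Compare_dec.lt_dec k 0); [lia|]. lra.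
    - rewrite flat_S, lsum_app. assert (p := Rinv_0_lt_compat _ (pow4_pos K)).
      replace (/ 4 ^ S K) with (/ 4 ^ K / 4) by (simpl; field; apply pow_nonzero; lra).
      destruct (PeanoNat.Nat.eq_dec k K) as [->|Hne].
      + assert (h := Lf_row K x Hx).
        destruct (Compare_dec.lt_dec K K), (Compare_dec.lt_dec K (S K)); try lia. lra.
      + assert (h : lsum (fun y => kerm (pt y) (pt x)) (Lf K) <= / 4 ^ (K + 2)).
        { eapply Rle_trans; [|apply (Lf_len K)]. apply lsum_le. intros y Hy.
          destruct (Lf_tiles K y Hy) as (my & _ & iy). destruct (Lf_tiles k x Hx) as (mx & _ & ix).
          apply (kerm_pt_cross K k); auto. lia. }
        replace (/ 4 ^ (K + 2)) with (/ 4 ^ K / 16) in h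
          by (rewrite pow_add; simpl; field; apply pow_nonzero; lra).
        destruct (Compare_dec.lt_dec k K), (Compare_dec.lt_dec k (S K)); try lia; lra. }
  assert (p := Rinv_0_lt_compat _ (pow4_pos K)).
  destruct (Compare_dec.lt_dec k K); lra.
Qed.

Lemma interpolating_tile_seq : interpolating (fun n => pt (tile_seq n)).
Proof.
  apply interpolating_of_row_sums.
  - intros n. apply Cmod_pt_lt_1.
  - intros m N. destruct (tile_seq_In m) as [k Hk].
    eapply Rle_trans; [|apply (row_sum_flat k _ N Hk)].
    rewrite <- psum_tile_seq_flat. apply psum_mono; [|apply length_flat].
    intros n. apply kerm_nonneg.
Qed.

Lemma summand_series_diverges lambda : 0 < lambda ->
  is_lim_seq (sum_n (fun n => summand lambda (pt (tile_seq n)))) p_infty.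
Proof.
  intros Hl. apply is_lim_seq_spec. intros Y.
  (* A single stage [k] already exceeds [Y]: its total length is at least [4 ^ -k / 16 / 3072]. The
     extra 1 makes the inequality strict. *)
  destruct (exp_quadratic_unbounded lambda (/ 16 / 3072) (Y + 1) Hl ltac:(lra)) as [k Hk].
  exists (length (flat (S k))). intros n Hn. rewrite <- psum_sum_n.
  assert (P : forall t, 0 <= summand lambda (pt t)) by (intros; apply summand_nonneg, Cmod_pt_lt_1).
  apply Rlt_le_trans with (psum (fun n => summand lambda (pt (tile_seq n))) (length (flat (S k)))).
  - rewrite (psum_tile_seq_flat (fun t => summand lambda (pt t))), flat_S, lsum_app.
    assert (h0 : 0 <= lsum (fun t => summand lambda (pt t)) (flat k)) by (apply lsum_nonneg; auto).
    assert (h1 : exp (lambda * INR k ^ 2 / 2) * lsum len (Lf k) <= lsum (fun t => summand lambda (pt t)) (Lf k)).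
    { rewrite <- lsum_scal. apply lsum_le. intros t Ht. destruct (Lf_tiles k t Ht) as (mt & wt & _).
      apply summand_pt_ge; auto. lia. }
    assert (h2 : exp (lambda * INR k ^ 2 / 2) * (/ 16 / 3072 * / 4 ^ k) <= exp (lambda * INR k ^ 2 / 2) * lsum len (Lf k)).
    { apply Rmult_le_compat_l; [apply Rlt_le, exp_pos|].
      replace (/ 16 / 3072 * / 4 ^ k) with (/ 4 ^ (k + 2) / 3072); [apply Lf_len|].
      rewrite pow_add. simpl. field. apply pow_nonzero; lra. }
    lra.
  - apply psum_mono; auto.
Qed.

End Flattening.

Theorem theorem1p4 :
  exists (b : C -> C) (z : nat -> C),
    bloch b /\ interpolating z /\ (forall n, z n <> 0%C) /\
    forall lambda : R, 0 < lambda ->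
      is_lim_seq
        (sum_n (fun n =>
           exp (lambda * Cmod (Cminus (b (z n)) (b 0%C)) ^ 2
                / (- ln (1 - Cmod (z n) ^ 2))) * (1 - Cmod (z n) ^ 2)))
        p_infty.
Proof.
  set (Lf := fun k => proj1_sig (constructive_indefinite_description _ (stage_exists k))).
  assert (H := fun k => proj2_sig (constructive_indefinite_description _ (stage_exists k))).
  exists lac, (fun n => pt (tile_seq Lf n)).
  split; [exact bloch_lac|]. split; [|split].
  - apply interpolating_tile_seq; intros k; apply H.
  - intros n. destruct (tile_seq_In Lf (fun k => proj2 (proj2 (H k))) n) as [k Hk].
    destruct (proj1 (H k) _ Hk) as (hm & _).
    apply Cmod_gt_0. rewrite Cmod_pt. assert (h := len_le 1 (tile_seq Lf n) ltac:(lia)).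
    rewrite pow_1 in h. lra.
  - intros lambda Hl. apply (summand_series_diverges Lf); auto; intros k; apply H.
Qed.
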